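(* Let $\mathcal{E}$ be a Euclidean space, let $f:\mathcal{E}\to\mathbb{R}$ be $C^3$, let $\mathcal{M}$ be an embedded Riemannian submanifold of $\mathcal{E}$ with $\dim(\mathcal{M})=d$, and let $1\le k<d$. Let $\mathbf{w}^\star:=(\mathbf{x}^\star,P^\star)\in\mathrm{Gr}_k(\mathrm{T}\mathcal{M})$ and suppose that the Riemannian Hessian $\mathrm{Hess}_{\mathcal{M}}f(\mathbf{x}^\star)$ is nondegenerate with eigenvalues $\lambda_1^\star\le\cdots\le\lambda_k^\star<\lambda_{k+1}^\star\le\cdots\le\lambda_d^\star$. Then $\mathbf{w}^\star$ is a linearly steady state of the dynamic $\frac{\mathrm{d}\mathbf{w}}{\mathrm{d}t}(t)=\mathbf{h}(\mathbf{w}(t))$ on $\mathrm{Gr}_k(\mathrm{T}\mathcal{M})$, where $\mathbf{h}=(h_1,h_2)$ and, for $\mathbf{w}=(\mathbf{x},P)$, $$h_1(\mathbf{w}):=-R_{\mathbf{w}}\big(\mathrm{grad}_{\mathcal{M}}f(\mathbf{x})\big),\qquad h_2(\mathbf{w}):=-\big[P,[P,\mathrm{Hess}_{\mathcal{M}}f(\mathbf{x})]\big]+\widehat{\mathrm{II}}_{\mathbf{x}}(h_1(\mathbf{w}),P),$$ if and only if $\mathbf{x}^\star$ is an index-$k$ constrained saddle point of $f$ on $\mathcal{M}$ and $P^\star$ is the orthogonal projector onto the lowest $k$-dimensional invariant subspace of $\mathrm{Hess}_{\mathcal{M}}f(\mathbf{x}^\star)$ (the one associated with $\lambda_1^\s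tar,\dots,\lambda_k^\star$).
   Context: $\mathcal{M}\subset\mathcal{E}$ carries the metric induced by the inner product of $\mathcal{E}$; $\mathrm{Proj}_{\mathrm{T}_{\mathbf{x}}\mathcal{M}}$ is the orthogonal projector of $\mathcal{E}$ onto $\mathrm{T}_{\mathbf{x}}\mathcal{M}$; $\mathcal{S}(\mathcal{E})$ is the Euclidean space of self-adjoint linear operators on $\mathcal{E}$. For $\mathbf{a},\mathbf{b}\in\mathcal{E}$, $\mathbf{a}\mathbf{b}^\top$ denotes the operator $\mathbf{u}\mapsto\langle\mathbf{b},\mathbf{u}\rangle\mathbf{a}$. Grassmann bundle: $\mathrm{Gr}_k(\mathrm{T}\mathcal{M}):=\{(\mathbf{x},P)\mid\mathbf{x}\in\mathcal{M},\ P\in\mathrm{Gr}_k(\mathrm{T}_{\mathbf{x}}\mathcal{M})\}$, where $k$-dimensional subspaces of $\mathrm{T}_{\mathbf{x}}\mathcal{M}$ are identified with the orthogonal projectors $P\in\mathcal{S}(\mathcal{E})$ onto them ($P^2=P$, rank $k$, $\mathrm{Ran}(P)\subseteq\mathrm{T}_{\mathbf{x}}\mathcal{M}$). It is an embedded submanifold of $\mathcal{E}\times\mathcal{S}(\mathcal{E})$ of dimension $d+k(d-k)$, and $\mathbf{h}$ is a tangent vector field on it. Second fundamental form: $\mathrm{II}_{\mathbf{x}}(\mathbf{u},\mathbf{v}):=\mathrm{D}(\mathbf{y}\mapsto\mathrm{Proj}_{\mathrm{T}_{\mathbf{y}}\mathcal{M}})(\mathbf{x})[\mathbf{u}](\mathbf{v})$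 for $\mathbf{u},\mathbf{v}\in\mathrm{T}_{\mathbf{x}}\mathcal{M}$; for $Q=\sum_{\ell=1}^k\mathbf{u}_\ell\mathbf{u}_\ell^\top$ with $\mathbf{u}_1,\dots,\mathbf{u}_k$ orthonormal in $\mathrm{T}_{\mathbf{x}}\mathcal{M}$, $\widehat{\mathrm{II}}_{\mathbf{x}}(\mathbf{u},Q):=\sum_{\ell=1}^k\mathrm{II}_{\mathbf{x}}(\mathbf{u},\mathbf{u}_\ell)\mathbf{u}_\ell^\top+\sum_{\ell=1}^k\mathbf{u}_\ell\mathrm{II}_{\mathbf{x}}(\mathbf{u},\mathbf{u}_\ell)^\top$. Reflection: $R_{\mathbf{w}}(\mathbf{u}):=\mathbf{u}-2P\mathbf{u}$ for $\mathbf{u}\in\mathrm{T}_{\mathbf{x}}\mathcal{M}$, $\mathbf{w}=(\mathbf{x},P)$. $[A,B]:=AB-BA$. $\mathrm{Hess}_{\mathcal{M}}f(\mathbf{x})$ is regarded as an element of $\mathcal{S}(\mathcal{E})$ by extending it by zero on the normal space; its eigenvalues and nondegeneracy refer to the operator on $\mathrm{T}_{\mathbf{x}}\mathcal{M}$. An index-$k$ constrained saddle point of $f$ on $\mathcal{M}$ is a point $\mathbf{x}\in\mathcal{M}$ with $\mathrm{grad}_{\mathcal{M}}f(\mathbf{x})=0$ at which $\mathrm{Hess}_{\mathcal{M}}f(\mathbf{x})$ has exactly $k$ negative eigenvalues (counted with multiplicity). $\mathbf{w}^\star$ is a linearly steady state of the dynamic if $\mathbf{h}(\mathbf{w}^\star)=0$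 and all eigenvalues of the differential $\mathrm{D}\mathbf{h}(\mathbf{w}^\star)$, viewed as a linear map of $\mathrm{T}_{\mathbf{w}^\star}\mathrm{Gr}_k(\mathrm{T}\mathcal{M})$ into itself, have negative real parts. *)

(* Defs.v *)
(* MathComp / MathComp-Analysis.  The Euclidean space is 'cV[R]_n with the dot
   product, i.e. a Euclidean space written in an orthonormal basis; its linear
   operators are the matrices 'M[R]_n, the self-adjoint ones being the symmetric
   matrices, and a b^T is a *m b^T. *)
From HB Require Import structures.
From mathcomp Require Import all_boot all_order all_algebra.
From mathcomp Require Import all_classical all_reals all_analysis.
From mathcomp Require Import complex.
Set Implicit Arguments.
Unset Strict Implicit.
Unset Printing Implicit Defensive.
Import Order.TTheory GRing.Theory Num.Theory.
Import numFieldNormedType.Exports.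
Local Open Scope classical_set_scope.
Local Open Scope ring_scope.

(* Only meant for an open U and a finite-dimensional V, where it is equivalent to
   the continuity on U of the Frechet derivatives of order at most r. *)
Fixpoint Ck_on (R : realType) (V W : normedModType R) (r : nat) (U : set V)
    (f : V -> W) {struct r} : Prop :=
  if r is r'.+1 then
    (forall x, U x -> differentiable f x) /\
    (forall v, Ck_on r' U (fun x => 'D_v f x))
  else forall x, U x -> {for x, continuous f}.

Definition smooth_on (R : realType) (V W : normedModType R) (U : set V)
    (f : V -> W) : Prop := forall r, Ck_on r U f.

(* Slice charts: near each of its points, M is mapped by a diffeomorphism between
   open subsets of R^n onto the points whose last n - d coordinates vanish. *)
Definition embedded_submanifold (R : realType) (n d : nat)
    (M : set 'cV[R]_n) : Prop :=
  (d <= n)%N /\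
  forall x, M x ->
    exists (U V : set 'cV[R]_n) (phi psi : 'cV[R]_n -> 'cV[R]_n),
      [/\ open U, U x, open V, smooth_on U phi & smooth_on V psi] /\
      [/\ forall y, U y -> V (phi y) /\ psi (phi y) = y,
          forall z, V z -> U (psi z) /\ phi (psi z) = z
        & forall y, U y ->
            (M y <-> forall i : 'I_n, (d <= i)%N -> phi y i 0 = 0)].

Definition curve_through (R : realType) (V : normedModType R) (N : set V)
    (x v : V) : set (R -> V) :=
  [set c | [/\ exists2 e : R, 0 < e &
                 (forall t, ball (0 : R) e t -> N (c t)) /\
                 smooth_on (ball (0 : R) e) c,
               c 0 = x & derive1 c 0 = v]].

Definition tangent (R : realType) (V : normedModType R) (N : set V)
    (x : V) : set V :=
  [set v | exists c, curve_through N x v c].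

(* D F (x)[v] for F : N -> W, i.e. (F \o c)'(0) for a smooth curve c of N with
   c(0) = x and c'(0) = v.  The chosen curve is irrelevant when N is a submanifold
   and F is C^1 on N. *)
Definition mdiff (R : realType) (V W : normedModType R) (N : set V)
    (F : V -> W) (x v : V) : W :=
  derive1 (F \o xget (fun=> x) (curve_through N x v)) 0.

Definition is_basis (R : realType) (V : lmodType R) (S : set V) (m : nat)
    (b : 'I_m -> V) : Prop :=
  (forall v, S v <-> exists c : 'rV[R]_m, v = \sum_(i < m) c 0 i *: b i) /\
  (forall c : 'rV[R]_m, \sum_(i < m) c 0 i *: b i = 0 -> c = 0).

(* Coordinates are row vectors: row i of A holds those of L (b i). *)
Definition is_matrix_of (R : realType) (V : lmodType R) (S : set V) (L : V -> V)
    (m : nat) (b : 'I_m -> V) (A : 'M[R]_m) : Prop :=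
  is_basis S b /\ forall i, L (b i) = \sum_(j < m) A i j *: b j.

(* lam lists the eigenvalues, with algebraic multiplicities, of the operator L on
   the m-dimensional invariant subspace S. *)
Definition has_eigenvalues (R : realType) (V : lmodType R) (S : set V)
    (L : V -> V) (m : nat) (lam : m.-tuple R) : Prop :=
  exists (b : 'I_m -> V) (A : 'M[R]_m),
    is_matrix_of S L b A /\ char_poly A = \prod_(a <- lam) ('X - a%:P).

Definition linearly_steady (R : realType) (V : normedModType R) (N : set V)
    (h : V -> V) (w : V) : Prop :=
  h w = 0 /\
  exists (m : nat) (b : 'I_m -> V) (A : 'M[R]_m),
    is_matrix_of (tangent N w) (mdiff N h w) b A /\
    forall z : R[i], eigenvalue (map_mx (real_complex R) A) z -> complex.Re z < 0.

Definition dotv (R : realType) (n : nat) (u v : 'cV[R]_n) : R := (u^T *m v) 0 0.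

Definition is_orthoproj (R : realType) (n : nat) (S : set 'cV[R]_n)
    (P : 'M[R]_n) : Prop :=
  [/\ P^T = P, P *m P = P & range (fun u : 'cV[R]_n => P *m u) = S].

Definition proj_tangent (R : realType) (n : nat) (M : set 'cV[R]_n)
    (x : 'cV[R]_n) : 'M[R]_n :=
  xget 0 [set P | is_orthoproj (tangent M x) P].

Definition rgrad (R : realType) (n : nat) (M : set 'cV[R]_n)
    (f : 'cV[R]_n -> R) (x : 'cV[R]_n) : 'cV[R]_n :=
  xget 0 [set g | tangent M x g /\
                  forall v, tangent M x v -> dotv g v = mdiff M f x v].

(* Levi-Civita connection of a submanifold of a Euclidean space:
   Hess f(x)[u] = Proj_{T_x M} (D grad_M f (x)[u]) for u in T_x M. *)
Definition rhess_tangent (R : realType) (n : nat) (M : set 'cV[R]_n)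
    (f : 'cV[R]_n -> R) (x u : 'cV[R]_n) : 'cV[R]_n :=
  proj_tangent M x *m mdiff M (rgrad M f) x u.

(* Matrix of the extension by zero on the normal space: column j is the image of
   the tangential part of the j-th basis vector. *)
Definition rhess (R : realType) (n : nat) (M : set 'cV[R]_n)
    (f : 'cV[R]_n -> R) (x : 'cV[R]_n) : 'M[R]_n :=
  \matrix_(i, j) rhess_tangent M f x (proj_tangent M x *m delta_mx j 0) i 0.

Definition nondegenerate_on (R : realType) (n : nat) (S : set 'cV[R]_n)
    (H : 'M[R]_n) : Prop := forall u, S u -> H *m u = 0 -> u = 0.

Definition saddle_point (R : realType) (n d : nat) (M : set 'cV[R]_n)
    (f : 'cV[R]_n -> R) (k : nat) (x : 'cV[R]_n) : Prop :=
  [/\ M x, rgrad M f x = 0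
    & exists lam : d.-tuple R,
        has_eigenvalues (tangent M x) (mulmx (rhess M f x)) lam /\
        count (fun a => a < 0) lam = k].

(* Sum of the eigenspaces of H in S for the first k entries of lam. *)
Definition first_invariant_subspace (R : realType) (n : nat)
    (S : set 'cV[R]_n) (H : 'M[R]_n) (lam : seq R) (k : nat) :
    set 'cV[R]_n :=
  [set v | exists u : 'I_k -> 'cV[R]_n,
     (forall i, S (u i) /\ H *m u i = lam`_i *: u i) /\
     v = \sum_(i < k) u i].

Definition grassmann_bundle (R : realType) (n : nat) (M : set 'cV[R]_n)
    (k : nat) : set ('cV[R]_n * 'M[R]_n) :=
  [set w | [/\ M w.1, w.2^T = w.2, w.2 *m w.2 = w.2, \rank w.2 = k
             & forall u, tangent M w.1 (w.2 *m u)]].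

Definition second_ff (R : realType) (n : nat) (M : set 'cV[R]_n)
    (x u v : 'cV[R]_n) : 'cV[R]_n :=
  mdiff M (proj_tangent M) x u *m v.

Definition is_frame (R : realType) (n : nat) (S : set 'cV[R]_n) (k : nat)
    (Q : 'M[R]_n) (u : 'I_k -> 'cV[R]_n) : Prop :=
  [/\ forall l, S (u l),
      forall l l', dotv (u l) (u l') = (l == l')%:R
    & Q = \sum_(l < k) u l *m (u l)^T].

(* The value does not depend on the chosen orthonormal frame of Q. *)
Definition second_ff_hat (R : realType) (n : nat) (M : set 'cV[R]_n) (k : nat)
    (x u : 'cV[R]_n) (Q : 'M[R]_n) : 'M[R]_n :=
  let q : 'I_k -> 'cV[R]_n :=
    xget (fun=> 0) [set q | is_frame (tangent M x) Q q] in
  \sum_(l < k) second_ff M x u (q l) *m (q l)^T +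
  \sum_(l < k) q l *m (second_ff M x u (q l))^T.

Definition commutator (R : realType) (n : nat) (A B : 'M[R]_n) : 'M[R]_n :=
  A *m B - B *m A.

Definition reflection (R : realType) (n : nat) (w : 'cV[R]_n * 'M[R]_n)
    (u : 'cV[R]_n) : 'cV[R]_n := u - 2 *: (w.2 *m u).

Definition saddle_field1 (R : realType) (n : nat) (M : set 'cV[R]_n)
    (f : 'cV[R]_n -> R) (w : 'cV[R]_n * 'M[R]_n) : 'cV[R]_n :=
  - reflection w (rgrad M f w.1).

Definition saddle_field2 (R : realType) (n : nat) (M : set 'cV[R]_n)
    (f : 'cV[R]_n -> R) (k : nat) (w : 'cV[R]_n * 'M[R]_n) : 'M[R]_n :=
  - commutator w.2 (commutator w.2 (rhess M f w.1)) +
  second_ff_hat M k w.1 (saddle_field1 M f w) w.2.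

Definition saddle_field (R : realType) (n : nat) (M : set 'cV[R]_n)
    (f : 'cV[R]_n -> R) (k : nat) (w : 'cV[R]_n * 'M[R]_n) :
    'cV[R]_n * 'M[R]_n :=
  (saddle_field1 M f w, saddle_field2 M f k w).

(* Main.v *)
(** Let H be the Hessian at x, and let Pi be the tangent projector. Since
    I - 2 P is invertible, h(x, P) = 0 means that grad f(x) = 0 and that P
    commutes with H.  Tangent vectors of the Grassmann bundle at (x, P) are the
    pairs (u, K P + P K + Om), where u is tangent to M, K = D Pi(x)[u] and Om is
    a symmetric operator exchanging Ran P and Ran (Pi - P).  At a zero of h the
    differential is block triangular in (u, Om): it acts on u by -(I - 2 P) H,
    that is by H on Ran P and by -H on Ran (Pi - P), and on Om by
    Om |-> -[P, [Om, H]], whose eigenvalues are the differences a - b with a an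
    eigenvalue of H on Ran P and b one on Ran (Pi - P).  Hence all eigenvalues
    have negative real parts iff H is negative on Ran P and positive on
    Ran (Pi - P). *)
Require Import Defs.
From HB Require Import structures.
From mathcomp Require Import all_boot all_order all_algebra.
From mathcomp Require Import all_classical all_reals all_analysis.
From mathcomp Require Import perm complex ring lra.
Import Order.TTheory GRing.Theory Num.Theory.
Import numFieldNormedType.Exports.
Local Open Scope classical_set_scope.
Local Open Scope ring_scope.

Set Implicit Arguments.
Unset Strict Implicit.
Unset Printing Implicit Defensive.


(** * Maps of class C^k *)

Section Ck.
Context {R : realType}.
Implicit Types (V W : normedModType R) (r : nat).

(** Tangent vectors are velocities of smooth curves and [mdiff] differentiates along one chosen
    curve, so each derivative has to be found along an arbitrary curve. A slice chart makes this
    possible: projector, gradient and Hessian become C^r functions on an open subset of R^n, and an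
    identity valid along the curve near 0 is differentiated by uniqueness of the derivative. That f
    is C^3 makes the Hessian C^1, hence the field differentiable. The obstacle is that the tangent
    spaces turn with the base point: D Pi enters the velocity of P, the derivative of H and the
    curvature term of h_2. These contributions cancel up to the lift of the new base velocity,
    whence the block triangular form. The two implications use the blocks differently: for
    necessity, functionals of u alone already carry both sign conditions, whereas sufficiency works
    with the complete matrix, where the differences a - b are negative as soon as both conditions
    hold. *)

Lemma near_eq_differentiable V W (f g : V -> W) (x : V) :
  {near x, f =1 g} -> differentiable f x -> differentiable g x.
Proof.
move=> fg df.
have gx : g x = f x by rewrite (nbhs_singleton fg).
have E : g \o shift x = cst (g x) + 'd f x +o_ 0 id.
  apply/eqaddoP => e e0; have /eqaddoP/(_ _ e0) H := diff_locally df.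
  have fg0 : \forall h \near 0, f (h + x) = g (h + x).
    by move: fg; rewrite (near_shift 0 x) subr0.
  near=> h.
  have := near H h; rewrite /= => /(_ _).
  rewrite gx.
  suff -> : (f \o shift x - (cst (f x) + 'd f x)) h = (g \o shift x - (cst (f x) + 'd f x)) h.
    by apply.
  rewrite -[LHS]/(f (h + x) - _) -[RHS]/(g (h + x) - _).
  by rewrite (near fg0 h).
apply/diff_locallyP.
have dE : 'd g x = 'd f x :> (V -> W).
  by apply: diff_unique => //; apply: diff_continuous.
rewrite dE; split => //; exact: diff_continuous.
Unshelve. all: by end_near. Qed.

Lemma near_open V (U : set V) (P : V -> Prop) x :
  open U -> U x -> (forall y, U y -> P y) -> \forall y \near x, P y.
Proof.
by move=> oU Ux UP; apply: filterS (open_nbhs_nbhs (conj oU Ux)).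
Qed.

Lemma Ck_ext V W r (U : set V) (f g : V -> W) :
  open U -> (forall x, U x -> f x = g x) -> Ck_on r U f -> Ck_on r U g.
Proof.
move=> oU; elim: r f g => [|r IH] f g fg /=.
  move=> cf x Ux; have := cf x Ux.
  move=> H; change (g @ x --> g x); rewrite -(fg x Ux); apply: cvg_trans H.
  apply: near_eq_cvg; apply: (near_open oU Ux) => y Uy; exact: fg.
move=> [df Df]; split=> [x Ux|v].
  by apply: near_eq_differentiable (df x Ux); apply: (near_open oU Ux).
apply: IH (Df v) => x Ux; apply: near_eq_derive.
by apply: (near_open oU Ux).
Qed.

Lemma Ck_sub V W r (U U' : set V) (f : V -> W) :
  U' `<=` U -> Ck_on r U f -> Ck_on r U' f.
Proof.
move=> sU; elim: r f => [|r IH] f /=; first by move=> cf x /sU; exact: cf.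
by move=> [df Df]; split=> [x /sU|v]; [exact: df|exact/IH/Df].
Qed.

Lemma Ck_weaken V W r (U : set V) (f : V -> W) : Ck_on r.+1 U f -> Ck_on r U f.
Proof.
elim: r f => [|r IH] f [df Df]; first by move=> x Ux; exact/differentiable_continuous/df.
by split => // v; exact/IH/Df.
Qed.

Lemma Ck_differentiable V W r (U : set V) (f : V -> W) x :
  Ck_on r.+1 U f -> U x -> differentiable f x.
Proof. by case=> df _; exact: df. Qed.

Lemma Ck_cst V W r (U : set V) (a : W) : Ck_on r U (fun _ : V => a).
Proof.
elim: r a => [|r IH] a /=; first by move=> x _; exact: cst_continuous.
split=> [x _|v]; first exact: differentiable_cst.
have -> : (fun x => 'D_v (fun=> a) x) = (fun=> 0) :> (V -> W).
  by apply/funext => x; rewrite derive_cst.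
exact: IH.
Qed.

Lemma Ck_linear V W r (U : set V) (l : {linear V -> W}) :
  continuous l -> Ck_on r U l.
Proof.
move=> cl; case: r => [|r] /=; first by move=> x _; exact: cl.
split=> [x _|v]; first exact: linear_differentiable.
have -> : (fun x => 'D_v l x) = (fun=> l v).
  apply/funext => x; rewrite deriveE; last exact: linear_differentiable.
  by rewrite diff_lin.
exact: Ck_cst.
Qed.

Lemma derive_linear V W W' (l : {linear W -> W'}) (f : V -> W) x v :
  continuous l -> differentiable f x ->
  'D_v (fun y => l (f y)) x = l ('D_v f x).
Proof.
move=> cl df; rewrite !deriveE//.
  by rewrite (diff_comp df (linear_differentiable _ cl)) /= diff_lin.
exact: (differentiable_comp df (linear_differentiable _ cl)).
Qed.

Lemma Ck_comp_linear V W W' r (U : set V) (l : {linear W -> W'}) (f : V -> W) :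
  open U -> continuous l -> Ck_on r U f -> Ck_on r U (fun x => l (f x)).
Proof.
move=> oU cl; elim: r f => [|r IH] f /=.
  by move=> cf x Ux; apply: continuous_comp; [exact: cf|exact: cl].
move=> [df Df]; split=> [x Ux|v].
  exact: (differentiable_comp (df x Ux) (linear_differentiable _ cl)).
apply: (Ck_ext oU) (IH _ (Df v)) => x Ux.
by rewrite derive_linear//; exact: df.
Qed.

Lemma Ck_add V W r (U : set V) (f g : V -> W) : open U ->
  Ck_on r U f -> Ck_on r U g -> Ck_on r U (fun x => f x + g x).
Proof.
move=> oU; elim: r f g => [|r IH] f g /=.
  by move=> cf cg x Ux; apply: continuousD; [exact: cf|exact: cg].
move=> [df Df] [dg Dg]; split=> [x Ux|v].
  exact: (differentiableD (df x Ux) (dg x Ux)).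
apply: (Ck_ext oU) (IH _ _ (Df v) (Dg v)) => x Ux.
by rewrite -[RHS]/('D_v (f + g) x) deriveD//; apply: diff_derivable; [exact: df|exact: dg].
Qed.

Lemma Ck_sum V W r (U : set V) (I : Type) (s : seq I) (P : pred I) (f : I -> V -> W) :
  open U -> (forall i, Ck_on r U (f i)) ->
  Ck_on r U (fun x => \sum_(i <- s | P i) f i x).
Proof.
move=> oU Cf; elim: s => [|a s IH].
  rewrite (_ : (fun x => _) = fun=> 0); first exact: Ck_cst.
  by apply/funext => x; rewrite big_nil.
rewrite (_ : (fun x => _) = (fun x => (if P a then f a x else 0) + \sum_(i <- s | P i) f i x)).
  apply: Ck_add => //; case: (P a) => //; exact: Ck_cst.
by apply/funext => x; rewrite big_cons; case: (P a) => //; rewrite add0r.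
Qed.

Lemma Ck_mul V r (U : set V) (f g : V -> R) : open U ->
  Ck_on r U f -> Ck_on r U g -> Ck_on r U (fun x => f x * g x).
Proof.
move=> oU; elim: r f g => [|r IH] f g.
  by move=> cf cg x Ux; apply: continuousM; [exact: cf|exact: cg].
move=> Cf Cg; move: (Cf) (Cg) => /= [df Df] [dg Dg]; split=> [x Ux|v].
  exact: (differentiableM (df x Ux) (dg x Ux)).
apply: (@Ck_ext _ _ _ _ (fun x => f x * 'D_v g x + g x * 'D_v f x) _ oU).
  move=> x Ux; rewrite -[RHS]/('D_v (f * g) x) deriveM//;
    apply: diff_derivable; [exact: df|exact: dg].
by apply: Ck_add => //; apply: IH => //; exact: Ck_weaken.
Qed.

Lemma Ck_prod V r (U : set V) (I : Type) (s : seq I) (P : pred I) (f : I -> V -> R) :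
  open U -> (forall i, Ck_on r U (f i)) ->
  Ck_on r U (fun x => \prod_(i <- s | P i) f i x).
Proof.
move=> oU Cf; elim: s => [|a s IH].
  rewrite (_ : (fun x => _) = fun=> 1); first exact: Ck_cst.
  by apply/funext => x; rewrite big_nil.
rewrite (_ : (fun x => _) = (fun x => (if P a then f a x else 1) * \prod_(i <- s | P i) f i x)).
  apply: Ck_mul => //; case: (P a) => //; exact: Ck_cst.
by apply/funext => x; rewrite big_cons; case: (P a) => //; rewrite mul1r.
Qed.

Lemma Ck_inv V r (U : set V) (f : V -> R) : open U ->
  (forall x, U x -> f x != 0) -> Ck_on r U f -> Ck_on r U (fun x => (f x)^-1).
Proof.
move=> oU f0; elim: r => [|r IH] Cf.
  by move=> x Ux; apply: continuousV; [exact: f0|exact: Cf].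
(* The derivative of 1 / f contains 1 / f again, whose class C^r is already given by the induction
   hypothesis. *)
have CV := IH (Ck_weaken Cf); move: Cf => /= [df Df].
split=> [x Ux|v].
  by apply: differentiableV; [exact: df|exact: f0].
apply: (@Ck_ext _ _ _ _ (fun x => (- 1) * ((f x)^-1 * (f x)^-1) * 'D_v f x) _ oU).
  move=> x Ux; rewrite deriveV//; [|exact: f0|exact/diff_derivable/df].
  by rewrite mulN1r -exprVn expr2.
by do !apply: Ck_mul => //; exact: Ck_cst.
Qed.

End Ck.

(** * Matrix-valued maps: entries, products, inverses, composition *)

Section CkMatrix.
Context {R : realType}.
Implicit Types (V W : normedModType R) (r p q : nat).

(** Taking an entry is bundled as a linear map, like [scalel] below, so that [Ck_comp_linear]
    applies to it. *)
Definition mxentry p q (i : 'I_p) (j : 'I_q) (A : 'M[R]_(p, q)) : R := A i j.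

Lemma mxentry_linear p q i j : linear (@mxentry p q i j).
Proof. by move=> a A B; rewrite /mxentry !mxE. Qed.

HB.instance Definition _ p q i j :=
  GRing.isLinear.Build R _ _ _ (@mxentry p q i j) (@mxentry_linear p q i j).

Definition scalel W (w : W) (a : R) : W := a *: w.

Lemma scalel_linear W w : linear (@scalel W w).
Proof. by move=> a b c; rewrite /scalel scalerDl scalerA. Qed.

HB.instance Definition _ W w :=
  GRing.isLinear.Build R _ _ _ (@scalel W w) (@scalel_linear W w).

Lemma Ck_mxP V p q r (U : set V) (F : V -> 'M[R]_(p, q)) : open U ->
  Ck_on r U F <-> (forall i j, Ck_on r U (fun x => F x i j)).
Proof.
move=> oU; split=> [CF i j|CF].
  apply: (Ck_comp_linear (l := @mxentry p q i j) oU _ CF).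
  exact: coord_continuous.
rewrite (_ : F = fun x => \sum_i \sum_j F x i j *: delta_mx i j); last first.
  by apply/funext => x; rewrite {1}(matrix_sum_delta (F x)).
do 2![apply: Ck_sum => // ?]; apply: (Ck_comp_linear (l := @scalel _ _) oU _ (CF _ _)).
exact: scalel_continuous.
Qed.

Lemma Ck_mulmx V p q s r (U : set V) (A : V -> 'M[R]_(p, q)) (B : V -> 'M[R]_(q, s)) :
  open U -> Ck_on r U A -> Ck_on r U B -> Ck_on r U (fun x => A x *m B x).
Proof.
move=> oU /(Ck_mxP _ _ oU) CA /(Ck_mxP _ _ oU) CB; apply/(Ck_mxP _ _ oU) => i j.
under eq_fun do rewrite mxE.
by apply: Ck_sum => // l; exact: Ck_mul.
Qed.

Lemma Ck_trmx V p q r (U : set V) (A : V -> 'M[R]_(p, q)) :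
  open U -> Ck_on r U A -> Ck_on r U (fun x => (A x)^T).
Proof.
move=> oU /(Ck_mxP _ _ oU) CA; apply/(Ck_mxP _ _ oU) => i j.
by under eq_fun do rewrite mxE.
Qed.

Lemma Ck_det V p r (U : set V) (A : V -> 'M[R]_p) :
  open U -> Ck_on r U A -> Ck_on r U (fun x => \det (A x)).
Proof.
move=> oU /(Ck_mxP _ _ oU) CA; rewrite /determinant; apply: Ck_sum => // s.
by apply: Ck_mul => //; [exact: Ck_cst|exact: Ck_prod].
Qed.

(** By Cramer's rule the inverse is the adjugate, polynomial in the entries, divided by a
    determinant that does not vanish on U. *)
Lemma Ck_invmx V p r (U : set V) (A : V -> 'M[R]_p) :
  open U -> (forall x, U x -> A x \in unitmx) -> Ck_on r U A ->
  Ck_on r U (fun x => invmx (A x)).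
Proof.
move=> oU uA CA.
apply: (@Ck_ext _ _ _ _ _ (fun x => (\det (A x))^-1 *: \adj (A x)) _ oU).
  by move=> x Ux; rewrite /invmx uA.
apply/(Ck_mxP _ _ oU) => i j; under eq_fun do rewrite !mxE.
apply: Ck_mul => //.
  apply: Ck_inv => //; last exact: Ck_det.
  by move=> x /uA; rewrite unitmxE unitfE.
apply: Ck_mul => //; first exact: Ck_cst.
apply: Ck_det => //; move/(Ck_mxP _ _ oU) : CA => CA.
by apply/(Ck_mxP _ _ oU) => a b; under eq_fun do rewrite !mxE.
Qed.

Lemma diff_mx_sum p q W (g : 'M[R]_(p, q) -> W) y v : differentiable g y ->
  'd g y v = \sum_i \sum_j v i j *: 'D_(delta_mx i j) g y.
Proof.
move=> dg; rewrite {1}(matrix_sum_delta v) linear_sum; apply: eq_bigr => i _.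
by rewrite linear_sum; apply: eq_bigr => j _; rewrite linearZ deriveE.
Qed.

Lemma derive_comp V W W' (f : V -> W) (g : W -> W') x v :
  differentiable f x -> differentiable g (f x) ->
  'D_v (fun y => g (f y)) x = 'd g (f x) ('D_v f x).
Proof.
move=> df dg; rewrite !deriveE//; last exact: (differentiable_comp df dg).
by rewrite (diff_comp df dg).
Qed.

(** [Ck_on] only sees derivatives in fixed directions, whereas the chain rule differentiates g in
    the moving direction ['D_v f x]. Expanding that direction on the elementary matrices leaves sums
    of products of functions covered by the induction. *)
Lemma Ck_comp_scalar V p q r (U : set V) (U' : set 'M[R]_(p, q))
    (f : V -> 'M[R]_(p, q)) (g : 'M[R]_(p, q) -> R) :
  open U -> open U' -> (forall x, U x -> U' (f x)) ->
  Ck_on r U f -> Ck_on r U' g -> Ck_on r U (fun x => g (f x)).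
Proof.
move=> oU oU' fU; elim: r f g fU => [|r IH] f g fU Cf Cg.
  move=> x Ux; apply: continuous_comp; [exact: Cf|exact/Cg/fU].
move: (Cf) (Cg) => /= [df Df] [dg Dg]; split=> [x Ux|v].
  exact: (differentiable_comp (df x Ux) (dg _ (fU _ Ux))).
apply: (@Ck_ext _ _ _ _ _ (fun x => \sum_i \sum_j
   'D_v f x i j * 'D_(delta_mx i j) g (f x)) _ oU).
  move=> x Ux; rewrite (@derive_comp _ _ _ f g); [|exact: df|exact/dg/fU].
  by rewrite diff_mx_sum//; exact/dg/fU.
apply: Ck_sum => // i; apply: Ck_sum => // j; apply: Ck_mul => //.
  by move/(Ck_mxP _ _ oU): (Df v); apply.
by apply: (IH f ('D_(delta_mx i j) g)) => //; exact: Ck_weaken.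
Qed.

Lemma Ck_comp V p q s t r (U : set V) (U' : set 'M[R]_(p, q))
    (f : V -> 'M[R]_(p, q)) (g : 'M[R]_(p, q) -> 'M[R]_(s, t)) :
  open U -> open U' -> (forall x, U x -> U' (f x)) ->
  Ck_on r U f -> Ck_on r U' g -> Ck_on r U (fun x => g (f x)).
Proof.
move=> oU oU' fU Cf /(Ck_mxP _ _ oU') Cg; apply/(Ck_mxP _ _ oU) => i j.
exact: (Ck_comp_scalar oU oU' fU Cf (Cg i j)).
Qed.

Lemma is_derive_mxP V p q (F : V -> 'M[R]_(p, q)) t v D :
  is_derive t v F D <-> (forall i j, is_derive t v (fun s => F s i j) (D i j)).
Proof.
split=> [[dF <-] i j|H].
  apply: DeriveDef; first exact: (derivable_mxP _ _ _).1.
  by rewrite derive_mx// mxE.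
have dF : derivable F t v by apply/derivable_mxP => i j; case: (H i j).
apply: DeriveDef => //; rewrite derive_mx//; apply/matrixP => i j.
by rewrite mxE; case: (H i j).
Qed.

Lemma is_derive_mulmx V p q s (A : V -> 'M[R]_(p, q)) (B : V -> 'M[R]_(q, s))
    t v dA dB : is_derive t v A dA -> is_derive t v B dB ->
  is_derive t v (fun x => A x *m B x) (dA *m B t + A t *m dB).
Proof.
move=> /is_derive_mxP HA /is_derive_mxP HB; apply/is_derive_mxP => i j.
rewrite (_ : (fun _ => _) = \sum_k ((fun x => A x i k) * (fun x => B x k j))); last first.
  by apply/funext => x; rewrite mxE fct_sumE.
rewrite !mxE -big_split/=; apply: is_derive_sum => k.
apply: is_derive_eq (is_deriveM (HA i k) (HB k j)) _.
by rewrite addrC; congr (_ + _); exact: mulrC.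
Qed.

Lemma is_derive_trmx V p q (A : V -> 'M[R]_(p, q)) t v dA :
  is_derive t v A dA -> is_derive t v (fun x => (A x)^T) dA^T.
Proof.
move=> /is_derive_mxP HA; apply/is_derive_mxP => i j; rewrite mxE.
by rewrite (_ : (fun _ => _) = (fun x => A x j i))//; apply/funext => x; rewrite mxE.
Qed.

Lemma is_derive_comp V W W' (f : V -> W) (g : W -> W') x v df :
  differentiable f x -> is_derive x v f df -> differentiable g (f x) ->
  is_derive x v (fun y => g (f y)) ('d g (f x) df).
Proof.
move=> Df [_ <-] Dg; apply: DeriveDef; last by rewrite derive_comp.
exact/diff_derivable/(differentiable_comp Df Dg).
Qed.

End CkMatrix.

(** * Symmetry of second derivatives *)

Section Schwarz.
Context {R : realType} {V : normedModType R}.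

Lemma is_derive_linear (W W' : normedModType R) (l : {linear W -> W'}) x v :
  continuous l -> is_derive x v l (l v).
Proof.
move=> cl; apply: DeriveDef; first exact/diff_derivable/linear_differentiable.
by rewrite deriveE ?diff_lin//; exact: linear_differentiable.
Qed.

Lemma is_derive_line (a v : V) (s : R) :
  is_derive s 1 (fun t : R => a + t *: v) v.
Proof.
have H := is_deriveD (is_derive_cst a s 1)
  (@is_derive_linear _ _ (@scalel R V v) s 1 (scalel_continuous (x:=v))).
by apply: is_derive_eq H _; rewrite add0r /= /scalel scale1r.
Qed.

Lemma differentiable_line (a v : V) (s : R) :
  differentiable (fun t : R => a + t *: v) s.
Proof. by apply/derivable1_diffP; case: (is_derive_line a v s). Qed.

Lemma is_derive_along_line (W : normedModType R) (g : V -> W) (a v : V) (s : R) :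
  differentiable g (a + s *: v) ->
  is_derive s 1 (fun t : R => g (a + t *: v)) ('D_v g (a + s *: v)).
Proof.
move=> dg; have := is_derive_comp (differentiable_line a v s) (is_derive_line a v s) dg.
by rewrite deriveE.
Qed.

Lemma MVT_line (g : V -> R) (a v : V) (h : R) : 0 < h ->
  (forall s, 0 <= s <= h -> differentiable g (a + s *: v)) ->
  exists2 s, 0 < s < h & g (a + h *: v) - g a = 'D_v g (a + s *: v) * h.
Proof.
move=> h0 dg.
have D s : s \in `]0, h[ ->
    is_derive s 1 (fun t : R => g (a + t *: v)) ('D_v g (a + s *: v)).
  by rewrite in_itv/= => /andP[s0 sh]; apply/is_derive_along_line/dg; rewrite !ltW.
have [|s sI E] := MVT h0 D.
  apply: derivable_within_continuous => s; rewrite in_itv/= => sI.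
  by have [] := is_derive_along_line (dg s sI).
exists s; first by move: sI; rewrite in_itv.
by move: E; rewrite subr0 scale0r addr0.
Qed.

Definition second_difference (g : V -> R) (x v w : V) (h : R) : R :=
  g (x + h *: v + h *: w) - g (x + h *: v) - (g (x + h *: w) - g x).

Lemma second_differenceC g x v w h :
  second_difference g x v w h = second_difference g x w v h.
Proof.
by rewrite /second_difference [x + h *: w + _]addrAC; ring.
Qed.

(** The mean value theorem is applied twice: in direction v to s |-> g (x + h w + s v) - g (x + s
    v), then in direction w to ['D_v g]. The second difference is thus h^2 times the mixed
    derivative at a point near x, and that derivative is continuous at x. *)
Lemma second_difference_approx (U : set V) (g : V -> R) x v w (e : R) :
  open U -> Ck_on 2 U g -> U x -> 0 < e ->
  \forall h \near 0^'+,
    `|second_difference g x v w h - 'D_w ('D_v g) x * h ^+ 2| <= e * h ^+ 2.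
Proof.
move=> oU [dg Dg] Ux e0; have [dDg DDg] := Dg v.
have /cvgrPdist_le/(_ _ e0) cD := DDg w x Ux.
have UD : nbhs x [set y | U y /\ `|'D_w ('D_v g) x - 'D_w ('D_v g) y| <= e].
  by apply: filterI => //; exact: open_nbhs_nbhs.
have [eta eta0 Heta] := (nbhs_ballP _ _).1 UD.
(* The intermediate points lie within h (|v| + |w|) of x; the extra 1 keeps the factor positive when
   v = w = 0, so that eta can be divided by it. *)
have K s t h : 0 <= s <= h -> 0 <= t <= h -> h * (`|v| + `|w| + 1) < eta ->
    U (x + s *: v + t *: w) /\
    `|'D_w ('D_v g) x - 'D_w ('D_v g) (x + s *: v + t *: w)| <= e.
  move=> /andP[s0 sh] /andP[t0 th] hlt; apply: Heta.
  rewrite -ball_normE /ball_/= -addrA opprD addNKr normrN.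
  apply: le_lt_trans hlt; apply: le_trans (ler_normD _ _) _.
  rewrite !normrZ (ger0_norm s0) (ger0_norm t0) -addrA mulrDr.
  have h0 : 0 <= h by exact: le_trans s0 sh.
  apply: lerD; first exact: ler_wpM2r.
  by rewrite mulrDr mulr1 -[leLHS]addr0; apply: lerD => //; exact: ler_wpM2r.
have N0 : 0 < `|v| + `|w| + 1 by rewrite ltr_wpDl// addr_ge0.
near=> h.
have h0 : 0 < h by near: h; exact: nbhs_right_gt.
have hlt : h * (`|v| + `|w| + 1) < eta.
  by rewrite -ltr_pdivlMr//; near: h; apply: nbhs_right_lt; exact: divr_gt0.
have hh : 0 <= h <= h by rewrite ltW/=.
have h00 : 0 <= (0 : R) <= h by rewrite lexx ltW.
have [s sI Es] : exists2 s, 0 < s < h & second_difference g x v w h =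
    ('D_v g (x + s *: v + h *: w) - 'D_v g (x + s *: v)) * h.
  have dk s : 0 <= s <= h ->
      is_derive s 1 (fun s => g (x + h *: w + s *: v) - g (x + s *: v))
        ('D_v g (x + h *: w + s *: v) - 'D_v g (x + s *: v)).
    move=> sI; apply: is_deriveB; apply/is_derive_along_line/dg.
      by rewrite addrAC; have [] := K s h h sI hh hlt.
    by have [] := K s 0 h sI h00 hlt; rewrite scale0r addr0.
  have dk' s : s \in `]0, h[ ->
      is_derive s 1 (fun s => g (x + h *: w + s *: v) - g (x + s *: v))
        ('D_v g (x + h *: w + s *: v) - 'D_v g (x + s *: v)).
    by rewrite in_itv/= => /andP[? ?]; apply: dk; rewrite !ltW.
  have [|s sI E] := MVT h0 dk'.
    apply: derivable_within_continuous => u; rewrite in_itv/= => uI.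
    by have [] := dk u uI.
  exists s; first by move: sI; rewrite in_itv.
  rewrite [x + s *: v + _]addrAC; move: E; rewrite subr0 !scale0r !addr0 => <-.
  by rewrite /second_difference [x + _ + h *: w]addrAC.
have sI' : 0 <= s <= h by case/andP: sI => ? ?; rewrite !ltW.
have [t tI Et] : exists2 t, 0 < t < h &
    'D_v g (x + s *: v + h *: w) - 'D_v g (x + s *: v) =
    'D_w ('D_v g) (x + s *: v + t *: w) * h.
  apply: MVT_line => // t tI; apply: dDg.
  by have [] := K s t h sI' tI hlt.
have tI' : 0 <= t <= h by case/andP: tI => ? ?; rewrite !ltW.
rewrite Es Et -mulrA -expr2 -mulrBl normrM (ger0_norm (sqr_ge0 _)).
by rewrite ler_wpM2r ?sqr_ge0// distrC; have [] := K s t h sI' tI' hlt.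
Unshelve. all: by end_near. Qed.

(** The second difference is symmetric in v and w, and divided by h^2 it approximates both mixed
    derivatives as h decreases to 0. *)
Lemma derive_comm (U : set V) (g : V -> R) x v w :
  open U -> Ck_on 2 U g -> U x -> 'D_w ('D_v g) x = 'D_v ('D_w g) x.
Proof.
move=> oU Cg Ux; apply/eqP; rewrite -subr_eq0 -normr_le0.
apply/ler_addgt0Pl => e e0; rewrite addr0.
have e20 : 0 < e / 2 by rewrite divr_gt0.
have A := second_difference_approx v w oU Cg Ux e20.
have B := second_difference_approx w v oU Cg Ux e20.
have [h [h0 [HA HB]]] := filter_ex (filterI (nbhs_right_gt 0) (filterI A B)).
rewrite -(@ler_pM2r _ (h ^+ 2)) ?exprn_gt0//.
rewrite -[X in _ * X](@ger0_norm _ (h ^+ 2)) ?sqr_ge0// -normrM mulrBl.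
apply: le_trans (ler_distD (second_difference g x v w h) _ _) _.
rewrite [e]splitr mulrDl; apply: lerD.
  rewrite distrC; exact: HA.
rewrite second_differenceC; exact: HB.
Qed.

End Schwarz.

(** * Orthogonal projectors and symmetric matrices *)

Section Euclidean.
Context {R : realType}.
Implicit Types (n d p r : nat).

Lemma tr_mulmx_eq0 n (u : 'cV[R]_n) : u^T *m u = 0 -> u = 0.
Proof.
move=> /matrixP/(_ 0 0); rewrite !mxE => /psumr_eq0P H.
apply/colP => i; have := H _ i isT; rewrite !mxE => H'.
by apply/eqP; rewrite -sqrf_eq0 expr2 H'// => j _; rewrite !mxE -expr2 sqr_ge0.
Qed.

(** B^T B a = 0 gives |B a|^2 = 0, hence B a = 0; the kernel of the matrix is treated row by row. *)
Lemma gram_unitmx n d (B : 'M[R]_(n, d)) :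
  (forall a : 'cV[R]_d, B *m a = 0 -> a = 0) -> B^T *m B \in unitmx.
Proof.
move=> injB; rewrite -unitmx_tr -row_free_unit -kermx_eq0; apply/eqP/row_matrixP => i.
rewrite row0; apply: trmx_inj; rewrite trmx0; apply: injB; apply: tr_mulmx_eq0.
have /(congr1 trmx) : row i (kermx (B^T *m B)^T) *m (B^T *m B)^T = 0.
  by rewrite -row_mul mulmx_ker row0.
rewrite trmx_mul trmxK trmx0 => E.
by rewrite trmx_mul -mulmxA [B^T *m (_ *m _)]mulmxA E mulmx0.
Qed.

(** Either projector fixes the range of the other, so P Q = Q and Q P = P; transposing the first
    gives Q P = Q. *)
Lemma orthoproj_uniq n (S : set 'cV[R]_n) (P Q : 'M[R]_n) :
  is_orthoproj S P -> is_orthoproj S Q -> P = Q.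
Proof.
move=> [Pt PP PS] [Qt QQ QS].
have absorb (A B : 'M[R]_n) : A *m A = A ->
    range (mulmx A : 'cV_n -> 'cV_n) = S -> range (mulmx B : 'cV_n -> 'cV_n) = S ->
    A *m B = B.
  move=> AA AS BS; apply/matrixP => i j.
  have [v _ Ev] : range (mulmx A : 'cV_n -> 'cV_n) (col j B).
    by rewrite AS -BS; exists (delta_mx j 0) => //; rewrite colE.
  have : A *m col j B = col j B by rewrite -Ev mulmxA AA.
  by move/colP/(_ i); rewrite !mxE => <-; apply: eq_bigr => l _; rewrite mxE.
have PQ := absorb P Q PP PS QS; have QP := absorb Q P QQ QS PS.
by rewrite -[RHS]Qt -PQ trmx_mul Pt Qt QP.
Qed.

(** The orthogonal projector onto the span of independent columns. No orthonormalization is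
    involved, so it is visibly as smooth as B. *)
Definition colproj n d (B : 'M[R]_(n, d)) : 'M[R]_n :=
  B *m invmx (B^T *m B) *m B^T.

Lemma gram_inv_sym n d (B : 'M[R]_(n, d)) :
  (invmx (B^T *m B))^T = invmx (B^T *m B).
Proof. by rewrite trmx_inv trmx_mul trmxK. Qed.

Lemma colproj_sym n d (B : 'M[R]_(n, d)) : (colproj B)^T = colproj B.
Proof. by rewrite /colproj !trmx_mul trmxK gram_inv_sym mulmxA. Qed.

Lemma colprojK n d (B : 'M[R]_(n, d)) :
  B^T *m B \in unitmx -> colproj B *m B = B.
Proof. by move=> uB; rewrite /colproj -!mulmxA mulVmx// mulmx1. Qed.

Lemma colproj_idem n d (B : 'M[R]_(n, d)) :
  B^T *m B \in unitmx -> colproj B *m colproj B = colproj B.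
Proof. by move=> uB; rewrite {2}/colproj !mulmxA colprojK. Qed.

Lemma mulmx_colproj n d (T : 'M[R]_n) (B : 'M[R]_(n, d)) :
  T *m B = B -> T *m colproj B = colproj B.
Proof. by move=> TB; rewrite /colproj !mulmxA TB. Qed.

Lemma colproj_orthoproj n d (B : 'M[R]_(n, d)) :
  B^T *m B \in unitmx ->
  is_orthoproj (range (mulmx B : 'cV_d -> 'cV_n)) (colproj B).
Proof.
move=> uB; split; [exact: colproj_sym|exact: colproj_idem|].
apply/seteqP; split => [_ [v _ <-]|_ [v _ <-]].
  by exists (invmx (B^T *m B) *m B^T *m v) => //; rewrite !mulmxA.
by exists (B *m v) => //; rewrite mulmxA colprojK.
Qed.

End Euclidean.

(** * Spectral theorem on the range of a commuting projector *)

Section Spectral.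
Context {R : realType}.
Implicit Types (n m r : nat).

(* x + i y is an eigenvector of A over R[i] for the eigenvalue a + i b. *)
Lemma complex_eigenvector m (A : 'M[R]_m) : (0 < m)%N ->
  exists (a b : R) (x y : 'rV[R]_m),
    [/\ x *m A = a *: x - b *: y, y *m A = b *: x + a *: y
      & ~ (x = 0 /\ y = 0)].
Proof.
move=> m0.
have [[a b] /eigenvalueP[v vA v0]] :=
  @spectral.eigenvalue_closed R[i] m (map_mx (real_complex R) A) m0.
have ReS (s : seq 'I_m) (F : 'I_m -> R[i]) :
    complex.Re (\sum_(i <- s) F i) = \sum_(i <- s) complex.Re (F i).
  by elim/big_rec2 : _ => // i x y _ <-; case: (F i) y => [? ?] [].
have ImS (s : seq 'I_m) (F : 'I_m -> R[i]) :
    complex.Im (\sum_(i <- s) F i) = \sum_(i <- s) complex.Im (F i).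
  by elim/big_rec2 : _ => // i x y _ <-; case: (F i) y => [? ?] [].
exists a, b, (\row_j complex.Re (v 0 j)), (\row_j complex.Im (v 0 j)); split.
- apply/rowP => j; move/rowP/(_ j)/(congr1 (@complex.Re R)): vA.
  rewrite !mxE ReS; case: (v 0 j) => c d /= <-.
  apply: eq_bigr => i _; rewrite !mxE; case: (v 0 i) => s t /=.
  by rewrite mulr0 subr0.
- apply/rowP => j; move/rowP/(_ j)/(congr1 (@complex.Im R)): vA.
  rewrite !mxE ImS; case: (v 0 j) => c d /=; rewrite addrC => <-.
  apply: eq_bigr => i _; rewrite !mxE; case: (v 0 i) => s t /=.
  by rewrite mulr0 add0r.
- move=> [/rowP Re0 /rowP Im0]; move/eqP: v0; apply; apply/rowP => j.
  move: (Re0 j) (Im0 j); rewrite !mxE; case: (v 0 j) => s t /= -> ->.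
  by [].
Qed.

(** A restricted to the row space of Q has a complex eigenvector X + i Y; symmetry makes its
    eigenvalue real, so X or Y is a real eigenvector, which is then normalized. *)
Lemma sym_eigenvector n (A Q : 'M[R]_n) :
  A^T = A -> Q^T = Q -> Q *m Q = Q -> Q *m A = A *m Q -> Q != 0 ->
  exists (mu : R) (v : 'cV[R]_n), [/\ v^T *m v = 1%:M, Q *m v = v & A *m v = mu *: v].
Proof.
move=> At Qt QQ QA Q0.
have r0 : (0 < \rank Q)%N by rewrite lt0n mxrank_eq0.
pose W := row_base Q.
have WQ : W *m Q = W.
  have /submxP[D ->] : (W <= Q)%MS by rewrite eq_row_base.
  by rewrite -mulmxA QQ.
(* The row space of W is stable under A because A commutes with Q, so [W *m A *m pinvmx W] is the
   matrix of the restriction. *)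
have WA : W *m A *m pinvmx W *m W = W *m A.
  apply: mulmxKpV; rewrite eq_row_base -WQ -mulmxA QA mulmxA; exact: submxMl.
have [a [b [x [y [Ex Ey xy0]]]]] := complex_eigenvector (W *m A *m pinvmx W) r0.
have Ex' : x *m W *m A = a *: (x *m W) - b *: (y *m W).
  by rewrite -mulmxA -WA mulmxA Ex mulmxBl !scalemxAl.
have Ey' : y *m W *m A = b *: (x *m W) + a *: (y *m W).
  by rewrite -mulmxA -WA mulmxA Ey mulmxDl !scalemxAl.
pose X := x *m W; pose Y := y *m W; pose xx := (X *m X^T) 0 0; pose yy := (Y *m Y^T) 0 0.
have dge0 (u : 'rV[R]_n) : 0 <= (u *m u^T) 0 0.
  by rewrite mxE sumr_ge0// => i _; rewrite mxE -expr2 sqr_ge0.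
have d0 (u : 'rV[R]_n) : (u *m u^T) 0 0 = 0 -> u = 0.
  move=> u0; apply: trmx_inj; rewrite trmx0; apply: tr_mulmx_eq0.
  by apply/matrixP => i j; rewrite trmxK !ord1 u0 mxE.
have XY0 : ~ (X = 0 /\ Y = 0).
  have fW := row_free_inj (row_base_free Q).
  by move=> [X0 Y0]; apply: xy0; split; apply: (fW); rewrite mul0mx.
(* Comparing X A Y^T with the transpose of Y A X^T gives b (|X|^2 + |Y|^2) = 0. *)
have b0 : b = 0.
  have symA (u w : 'rV[R]_n) : u *m A *m w^T = (w *m A *m u^T)^T.
    by rewrite !trmx_mul trmxK At mulmxA.
  have C (u w : 'rV[R]_n) : u *m w^T = (w *m u^T)^T by rewrite trmx_mul trmxK.
  have E := symA X Y.
  move: E; rewrite Ex' Ey' -/X -/Y mulmxBl mulmxDl -!scalemxAl (C X Y).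
  move=> /matrixP/(_ 0 0); rewrite !mxE -/xx -/yy.
  move=> E; have {}E : b * (xx + yy) = 0.
    have -> : xx = (X *m X^T) 0 0 by []; have -> : yy = (Y *m Y^T) 0 0 by [].
    by move: E; rewrite !mxE; lra.
  move/eqP: E; rewrite mulf_eq0 => /orP[/eqP//|].
  rewrite paddr_eq0 ?dge0// => /andP[/eqP/d0 X0 /eqP/d0 Y0].
  by case: XY0.
have {}Ex' : X *m A = a *: X by rewrite Ex' b0 scale0r subr0.
have {}Ey' : Y *m A = a *: Y by rewrite Ey' b0 scale0r add0r.
have [u [u0 uA uQ]] : exists u : 'rV[R]_n, [/\ u != 0, u *m A = a *: u & u *m Q = u].
  have [X0|X0] := eqVneq X 0; last by exists X; split => //; rewrite -mulmxA WQ.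
  have [Y0|Y0] := eqVneq Y 0; last by exists Y; split => //; rewrite -mulmxA WQ.
  by case: XY0.
have c0 : 0 < (u *m u^T) 0 0.
  by rewrite lt0r dge0 andbT; apply: contra u0 => /eqP/d0 ->.
exists a, ((Num.sqrt ((u *m u^T) 0 0))^-1 *: u^T); split.
- rewrite !linearZ/= trmxK -scalemxAl scalerA.
  apply/matrixP => i j; rewrite !ord1 mxE [RHS]mxE eqxx.
  by rewrite -invfM -expr2 sqr_sqrtr ?ltW// mulVf// gt_eqF.
- by rewrite -scalemxAr -{1}Qt -trmx_mul uQ.
- by rewrite -scalemxAr -{1}At -trmx_mul uA linearZ/= !scalerA mulrC.
Qed.

Lemma rank_frame n r (Q : 'M[R]_n) (E : 'M[R]_(n, r)) :
  E^T *m E = 1%:M -> E *m E^T = Q -> \rank Q = r.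
Proof.
move=> EE EQ; apply/eqP; rewrite eqn_leq; apply/andP; split.
  by rewrite -EQ; apply: leq_trans (mxrankM_maxl _ _) (rank_leq_col _).
rewrite -{1}(mxrank1 R r) -EE; apply: leq_trans (mxrankM_maxr _ _) _.
by rewrite -[E]mulmx1 -EE mulmxA EQ mxrankM_maxl.
Qed.

(** Deflation: for a unit eigenvector v in Ran Q, the operator Q - v v^T is again a projector
    commuting with A, of smaller rank. *)
Lemma spectral_projector n (A Q : 'M[R]_n) r :
  A^T = A -> Q^T = Q -> Q *m Q = Q -> Q *m A = A *m Q -> \rank Q = r ->
  exists (E : 'M[R]_(n, r)) (mu : 'rV[R]_r),
    [/\ E^T *m E = 1%:M, E *m E^T = Q & A *m E = E *m diag_mx mu].
Proof.
move=> At Qt QQ QA rQ.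
(* The number s of columns stays free during the induction; [rank_frame] identifies it with r
   afterwards. *)
suff [s [E [mu [EE EQ EA]]]] : exists s (E : 'M[R]_(n, s)) (mu : 'rV[R]_s),
    [/\ E^T *m E = 1%:M, E *m E^T = Q & A *m E = E *m diag_mx mu].
  have sr : s = r by rewrite -rQ (rank_frame EE EQ).
  by subst s; exists E, mu.
move: {2}(\rank Q).+1 (ltnSn (\rank Q)) => N.
elim: N Q r Qt QQ QA {rQ} => // N IH Q _ Qt QQ QA lQ.
have [Q0|Q0] := eqVneq Q 0.
  exists 0, 0, 0; split; [by apply/matrixP; case| |by apply/matrixP => i; case].
  by rewrite mul0mx Q0.
have [mu [v [vv Qv Av]]] := sym_eigenvector At Qt QQ QA Q0.
have vQ : v^T *m Q = v^T by rewrite -{1}Qt -trmx_mul Qv.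
have vA : v^T *m A = mu *: v^T by rewrite -{1}At -trmx_mul Av linearZ.
pose Q' := Q - v *m v^T.
have Q't : Q'^T = Q' by rewrite /Q' linearB/= trmx_mul trmxK Qt.
have vQ' : v^T *m Q' = 0 by rewrite mulmxBr vQ mulmxA vv mul1mx subrr.
have Q'Q : Q' *m Q = Q' by rewrite mulmxBl QQ -mulmxA vQ.
have Q'Q' : Q' *m Q' = Q'.
  by rewrite {2}/Q' mulmxBr Q'Q mulmxA -[Q' *m v]trmxK trmx_mul Q't vQ' trmx0 mul0mx subr0.
have Q'A : Q' *m A = A *m Q'.
  by rewrite mulmxBl mulmxBr QA -mulmxA vA mulmxA Av -scalemxAr -scalemxAl.
have rQ' : (\rank Q' < N)%N.
  rewrite ltnS in lQ; apply: leq_trans lQ; apply: rank_ltmx; rewrite ltmxE.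
  rewrite -{1}Q'Q submxMl/=; apply/negP => QQ'.
  have /submxP[D ED] : (v^T <= Q')%MS by apply: submx_trans QQ'; rewrite -vQ submxMl.
  have v0 : v^T = 0 by rewrite ED -Q'Q' mulmxA -ED vQ'.
  by move/matrixP: vv => /(_ 0 0); rewrite v0 mul0mx !mxE => /eqP; rewrite eq_sym oner_eq0.
have [s [E [nu [EE EQ EA]]]] := IH Q' 0%N Q't Q'Q' Q'A rQ'.
have vE : v^T *m E = 0.
  by rewrite -[E]mulmx1 -EE [E *m _]mulmxA EQ mulmxA vQ' mul0mx.
have Ev : E^T *m v = 0 by rewrite -[LHS]trmxK trmx_mul trmxK vE trmx0.
exists (1 + s)%N, (row_mx v E), (row_mx mu%:M nu); split.
- by rewrite tr_row_mx mul_col_row vv vE Ev EE -scalar_mx_block.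
- by rewrite tr_row_mx mul_row_col EQ addrC subrK.
- rewrite mul_mx_row diag_mx_row mul_row_block !mulmx0 addr0 add0r EA Av.
  congr row_mx; rewrite -mul_mx_scalar; congr mulmx.
  by apply/matrixP => i j; rewrite !ord1 !mxE.
Qed.

Lemma orthonormal_frame n (Q : 'M[R]_n) r :
  Q^T = Q -> Q *m Q = Q -> \rank Q = r ->
  exists2 E : 'M[R]_(n, r), E^T *m E = 1%:M & E *m E^T = Q.
Proof.
move=> Qt QQ rQ; have [||E [_ [EE EQ _]]] := @spectral_projector _ 0 Q r _ Qt QQ _ rQ.
- by rewrite trmx0.
- by rewrite mulmx0 mul0mx.
by exists E.
Qed.

End Spectral.

(** * Eigenvalues of an operator on an invariant subspace *)

Section Bases.
Context {R : realType}.
Implicit Types (n m p : nat).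

(** C intertwines X - A' and X - A over the polynomials; its determinant is a nonzero constant and
    cancels. *)
Lemma char_poly_similar (F : fieldType) m (C A A' : 'M[F]_m) :
  C \in unitmx -> A' *m C = C *m A -> char_poly A' = char_poly A.
Proof.
move=> uC E; pose Cp := map_mx polyC C.
have EC : char_poly_mx A' *m Cp = Cp *m char_poly_mx A.
  rewrite /char_poly_mx mulmxBl mulmxBr -!map_mxM E; congr (_ - _).
  by rewrite scalar_mxC.
have C0 : \det Cp != 0.
  by rewrite det_map_mx polyC_eq0 -unitfE -unitmxE.
apply: (mulIf C0); rewrite [RHS]mulrC.
by rewrite /char_poly -!det_mulmx EC.
Qed.

(** Vectors are stored as rows to agree with the row coordinates of [is_matrix_of]: the operator H
    then acts by right multiplication by H^T. *)
Definition basis_mx n m (b : 'I_m -> 'cV[R]_n) : 'M[R]_(m, n) :=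
  \matrix_i (b i)^T.

Lemma sum_basis_mx n m (b : 'I_m -> 'cV[R]_n) (c : 'rV[R]_m) :
  \sum_i c 0 i *: b i = (c *m basis_mx b)^T.
Proof.
apply/colP => j; rewrite summxE !mxE; apply: eq_bigr => i _.
by rewrite !mxE.
Qed.

Lemma basis_in (X : lmodType R) m (S : set X) (b : 'I_m -> X) i :
  is_basis S b -> S (b i).
Proof.
move=> [bS _]; apply/bS; exists (delta_mx 0 i).
rewrite (bigD1 i)//= mxE !eqxx scale1r big1 ?addr0// => j ji.
by rewrite mxE (negbTE ji) andbF scale0r.
Qed.

Lemma basis_mx_inj n m p (S : set 'cV[R]_n) (b : 'I_m -> 'cV[R]_n) (X Y : 'M[R]_(p, m)) :
  is_basis S b -> X *m basis_mx b = Y *m basis_mx b -> X = Y.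
Proof.
move=> [_ bfree] XY; apply/subr0_eq/row_matrixP => i; rewrite row0; apply: bfree.
by rewrite sum_basis_mx -row_mul mulmxBl XY subrr row0 trmx0.
Qed.

Lemma basis_mx_change n m p (S : set 'cV[R]_n) (b : 'I_m -> 'cV[R]_n)
    (b' : 'I_p -> 'cV[R]_n) :
  is_basis S b -> (forall i, S (b' i)) ->
  exists C : 'M[R]_(p, m), basis_mx b' = C *m basis_mx b.
Proof.
move=> [bS _] Sb'.
have cP i : {c : 'rV[R]_m | b' i = \sum_j c 0 j *: b j}.
  by apply/cid; exact: (bS _).1.
exists (\matrix_i sval (cP i)); apply/row_matrixP => i.
rewrite row_mul !rowK; case: (cP i) => c /= ->.
by rewrite sum_basis_mx trmxK.
Qed.

Lemma matrix_of_mx n m (S : set 'cV[R]_n) (H : 'M[R]_n) (b : 'I_m -> 'cV[R]_n) A :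
  is_matrix_of S (mulmx H) b A -> basis_mx b *m H^T = A *m basis_mx b.
Proof.
move=> [_ HA]; apply/row_matrixP => i.
rewrite row_mul rowK -trmx_mul -[RHS]trmxK row_mul -(sum_basis_mx b (row i A)) HA.
by congr trmx; apply: eq_bigr => j _; rewrite mxE.
Qed.

(** The transition matrices between the two bases are inverse to each other and conjugate A into
    A'. *)
Lemma char_poly_basis_uniq n m (S : set 'cV[R]_n) (H : 'M[R]_n)
    (b b' : 'I_m -> 'cV[R]_n) (A A' : 'M[R]_m) :
  is_matrix_of S (mulmx H) b A -> is_matrix_of S (mulmx H) b' A' ->
  char_poly A = char_poly A'.
Proof.
move=> HA HA'; have [bb _] := HA; have [bb' _] := HA'.
have [C EC] := basis_mx_change bb (fun i => basis_in i bb').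
have [D ED] := basis_mx_change bb' (fun i => basis_in i bb).
have DC : D *m C = 1%:M.
  by apply: (basis_mx_inj bb); rewrite -mulmxA -EC -ED mul1mx.
have uC : C \in unitmx by case/mulmx1_unit: DC.
apply/esym/(char_poly_similar uC)/(basis_mx_inj bb).
by rewrite -!mulmxA -(matrix_of_mx HA) -EC -(matrix_of_mx HA') EC mulmxA.
Qed.

(* l is a left eigenvector of L on S. *)
Lemma functional_eigenvalue (X : lmodType R) (S : set X) (L : X -> X) m
    (b : 'I_m -> X) (A : 'M[R]_m) (l : X -> R) a :
  is_matrix_of S L b A ->
  (forall c : 'I_m -> R, l (\sum_i c i *: b i) = \sum_i c i * l (b i)) ->
  (forall i, l (L (b i)) = a * l (b i)) -> (exists2 v, S v & l v != 0) ->
  eigenvalue A a.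
Proof.
move=> [[bS _] LA] lD lL [v Sv lv]; pose c : 'cV[R]_m := \col_i l (b i).
have Ac : A *m c = a *: c.
  apply/colP => i; rewrite !mxE -lL LA lD; apply: eq_bigr => j _.
  by rewrite mxE.
have c0 : c != 0.
  apply: contra lv => /eqP/colP c0; have [r ->] := (bS v).1 Sv.
  rewrite lD big1// => i _; have := c0 i; rewrite !mxE => ->.
  by rewrite mulr0.
(* The column c is a right eigenvector, while [eigenvalue] speaks of row vectors; both mean that A -
   a is not invertible. *)
rewrite /eigenvalue /eigenspace kermx_eq0 row_free_unit; apply: contra c0 => uA.
by rewrite -[c](mulKmx uA) mulmxBl Ac mul_scalar_mx subrr mulmx0.
Qed.

Lemma eigenvalue_diag_mx (K : fieldType) m (D : 'rV[K]_m) (v : 'rV[K]_m) z :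
  v *m diag_mx D = z *: v -> v != 0 -> exists i, z = D 0 i.
Proof.
move=> vD /rV0Pn[i vi]; exists i; move/rowP/(_ i): vD.
by rewrite mul_mx_diag !mxE mulrC => /(mulIf vi).
Qed.

Lemma has_eigenvalues_perm n m (S : set 'cV[R]_n) (H : 'M[R]_n) (lam lam' : m.-tuple R) :
  has_eigenvalues S (mulmx H) lam -> has_eigenvalues S (mulmx H) lam' ->
  perm_eq lam lam'.
Proof.
move=> [b [A [HA EA]]] [b' [A' [HA' EA']]]; apply: prod_XsubC_eq.
by rewrite -EA -EA'; exact: char_poly_basis_uniq HA HA'.
Qed.

End Bases.

(** * Splitting the spectrum between Ran P and its complement in Ran Pi *)

Section Splitting.
Context {R : realType}.
Implicit Types (n d k r : nat).

(** In the basis of the columns of E the operator is diagonal, and the characteristic polynomial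
    does not depend on the basis. *)
Lemma orthonormal_eigenvalues n r (Pi H : 'M[R]_n) (E : 'M[R]_(n, r))
    (mu : 'rV[R]_r) (lam : r.-tuple R) :
  E^T *m E = 1%:M -> E *m E^T = Pi -> H *m E = E *m diag_mx mu ->
  has_eigenvalues (range (mulmx Pi : 'cV_n -> 'cV_n)) (mulmx H) lam ->
  perm_eq lam [seq mu 0 i | i : 'I_r].
Proof.
move=> EE EPi HE [b [A [HA EA]]].
have colE' (c : 'rV[R]_r) : \sum_i c 0 i *: col i E = E *m c^T.
  apply/colP => j; rewrite summxE !mxE; apply: eq_bigr => i _.
  by rewrite !mxE mulrC.
have HE' : is_matrix_of (range (mulmx Pi : 'cV_n -> 'cV_n)) (mulmx H)
    (fun i => col i E) (diag_mx mu).
  split.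
    split=> [v|c].
      split=> [[w _ <-]|[c ->]].
        by exists (E^T *m w)^T; rewrite colE' trmxK mulmxA EPi.
      by exists (E *m c^T) => //; rewrite colE' -EPi -mulmxA [E^T *m _]mulmxA EE mul1mx.
    rewrite colE' => E0; apply: trmx_inj; rewrite trmx0.
    by rewrite -[c^T]mul1mx -EE -mulmxA E0 mulmx0.
  move=> i; rewrite (bigD1 i)//= big1 => [|j ji]; last first.
    by rewrite mxE eq_sym (negbTE ji) mulr0n scale0r.
  rewrite addr0 mxE eqxx mulr1n; apply/colP => j.
  have : (H *m E) j i = (E *m diag_mx mu) j i by rewrite HE.
  rewrite mul_mx_diag !mxE mulrC => <-.
  by apply: eq_bigr => l _; rewrite mxE.
apply: prod_XsubC_eq; rewrite -EA (char_poly_basis_uniq HA HE').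
rewrite char_poly_trig ?diag_mx_is_trig// big_map big_enum.
by apply: eq_bigr => i _; rewrite mxE eqxx mulr1n.
Qed.

Lemma col_eigen n r (H : 'M[R]_n) (E : 'M[R]_(n, r)) (mu : 'rV[R]_r) i :
  H *m E = E *m diag_mx mu -> H *m col i E = mu 0 i *: col i E.
Proof.
move=> HE; rewrite !colE mulmxA HE -mulmxA; apply/colP => j; rewrite -colE !mxE.
rewrite mulr_sumr; apply: eq_bigr => l _; rewrite !mxE.
have [->|li] := eqVneq l i; last by rewrite !mulr0n !mulr0.
by rewrite /= !mulr1n mulr1 mulrC.
Qed.

(** H commutes with P and with Pi - P, so the spectral theorem applies to each. The two ranges are
    orthogonal, hence the frames concatenate to an orthonormal eigenframe of Ran Pi, which accounts
    for all of [lam]. *)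
Lemma eigen_split n d k (Pi P H : 'M[R]_n) (lam : d.-tuple R) :
  Pi^T = Pi -> Pi *m Pi = Pi -> \rank Pi = d ->
  P^T = P -> P *m P = P -> \rank P = k -> Pi *m P = P ->
  H^T = H -> Pi *m H = H -> P *m H = H *m P ->
  has_eigenvalues (range (mulmx Pi : 'cV_n -> 'cV_n)) (mulmx H) lam ->
  exists (E : 'M[R]_(n, k)) (mu : 'rV[R]_k) (r : nat) (F : 'M[R]_(n, r)) (nu : 'rV[R]_r),
  [/\ E^T *m E = 1%:M, E *m E^T = P & H *m E = E *m diag_mx mu] /\
  [/\ F^T *m F = 1%:M, F *m F^T = Pi - P, H *m F = F *m diag_mx nu &
    d = (k + r)%N /\ perm_eq lam ([seq mu 0 i | i : 'I_k] ++ [seq nu 0 i | i : 'I_r])].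
Proof.
move=> Pit PiPi rPi Pt PP rP PiP Ht PiH PH lamH.
have PPi : P *m Pi = P by rewrite -{1}Pt -Pit -trmx_mul PiP Pt.
have HPi : H *m Pi = H by rewrite -{1}Ht -Pit -trmx_mul PiH Ht.
have [E [mu [EE EP HE]]] := spectral_projector Ht Pt PP PH rP.
have Qt : (Pi - P)^T = Pi - P by rewrite linearB/= Pit Pt.
have QQ : (Pi - P) *m (Pi - P) = Pi - P.
  by rewrite mulmxBl !mulmxBr PiPi PiP PPi PP subrr subr0.
have QH : (Pi - P) *m H = H *m (Pi - P).
  by rewrite mulmxBl mulmxBr PiH HPi PH.
have [F [nu [FF FQ HF]]] := spectral_projector Ht Qt QQ QH (erefl _).
exists E, mu, (\rank (Pi - P)), F, nu; split; split => //.
have EF : E^T *m F = 0.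
  rewrite -[F]mulmx1 -FF -[E^T]mul1mx -EE !mulmxA -[_ *m E^T *m F *m F^T]mulmxA FQ.
  rewrite -[E^T *m E *m E^T]mulmxA EP -[E^T *m P *m _]mulmxA mulmxBr PPi PP subrr.
  by rewrite mulmx0 mul0mx.
have FE : F^T *m E = 0 by rewrite -[LHS]trmxK trmx_mul trmxK EF trmx0.
move: (\rank (Pi - P)) F nu FF FQ HF EF FE => r F nu FF FQ HF EF FE.
have EF1 : (row_mx E F)^T *m row_mx E F = 1%:M.
  by rewrite tr_row_mx mul_col_row EE EF FE FF -scalar_mx_block.
have EFPi : row_mx E F *m (row_mx E F)^T = Pi.
  by rewrite tr_row_mx mul_row_col EP FQ addrC subrK.
have dE : d = (k + r)%N by rewrite -rPi; exact: rank_frame EF1 EFPi.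
split=> //; clear rPi; subst d.
have HEF : H *m row_mx E F = row_mx E F *m diag_mx (row_mx mu nu).
  by rewrite diag_mx_row mul_mx_row mul_row_block !mulmx0 addr0 add0r HE HF.
have PE := orthonormal_eigenvalues EF1 EFPi HEF lamH. rewrite (permPl PE).
apply: prod_XsubC_eq; rewrite big_cat !big_image/= big_split_ord/=.
by congr (_ * _); apply: eq_bigr => i _; rewrite ?row_mxEl ?row_mxEr.
Qed.

Lemma count_neg_split k (s t : seq R) :
  all (fun a => a < 0) s -> all (fun a => 0 < a) t -> size s = k ->
  count (fun a => a < 0) (s ++ t) = k.
Proof.
move=> s0 t0 <-; rewrite count_cat (eqP (_ : count _ s == size s)); last by rewrite -all_count.
rewrite (_ : count _ t = 0%N) ?addn0//; apply/eqP; rewrite -leqn0 leqNgt -has_count.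
by apply/hasPn => x /(allP t0) x0; rewrite -leNgt ltW.
Qed.

(** If the entry of index i were nonnegative, so would be all later ones, and at most i < k entries
    could be negative. *)
Lemma sorted_count_neg (s : seq R) k i :
  sorted <=%R s -> count (fun a => a < 0) s = k -> (i < k)%N -> s`_i < 0.
Proof.
move=> ss <- ik; rewrite ltNge; apply/negP => si0; move: ik; rewrite ltnNge => /negP; apply.
rewrite -[s in X in (X <= _)%N](cat_take_drop i) count_cat.
rewrite (_ : count _ (drop i s) = 0%N) ?addn0.
  by apply: leq_trans (count_size _ _) _; rewrite size_take_min geq_minl.
apply/eqP; rewrite -leqn0 leqNgt -has_count; apply/hasPn => x /(nthP 0)[j].
rewrite size_drop => jl <-; rewrite nth_drop -leNgt; apply: le_trans si0 _.
apply: (le_sorted_leq_nth 0 ss); rewrite ?inE ?leq_addr//; move: jl; rewrite ltn_subRL//.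
exact: leq_ltn_trans (leq_addr _ _).
Qed.

End Splitting.

(** * The lowest invariant subspace and the signs of the eigenvalues *)

Section LowestSubspace.
Context {R : realType} (n d k : nat) (Pi P H : 'M[R]_n) (lam : d.-tuple R).
Hypotheses (Pit : Pi^T = Pi) (PiPi : Pi *m Pi = Pi) (rPi : \rank Pi = d)
  (Pt : P^T = P) (PP : P *m P = P) (rP : \rank P = k) (PiP : Pi *m P = P)
  (Ht : H^T = H) (PiH : Pi *m H = H)
  (lamH : has_eigenvalues (range (mulmx Pi : 'cV_n -> 'cV_n)) (mulmx H) lam)
  (lam_sorted : sorted <=%R lam).

Let S : set 'cV[R]_n := range (mulmx Pi : 'cV_n -> 'cV_n).

Let SE v : S v <-> Pi *m v = v.
Proof. by split=> [[w _ <-]|E]; [rewrite mulmxA PiPi|exists v]. Qed.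

Let PPi : P *m Pi = P.
Proof. by rewrite -{1}Pt -Pit -trmx_mul PiP Pt. Qed.

Let HPi : H *m Pi = H.
Proof. by rewrite -{1}Ht -Pit -trmx_mul PiH Ht. Qed.

Lemma frame_col_neq0 r (E : 'M[R]_(n, r)) i : E^T *m E = 1%:M -> col i E != 0.
Proof.
move=> EE; apply/eqP => E0; have := congr1 (fun A : 'M[R]_r => A i i) EE.
rewrite !mxE eqxx mulr1n => E1; have := oner_neq0 R; rewrite -E1 big1 ?eqxx// => j _.
by move/colP/(_ j): E0; rewrite !mxE => ->; rewrite mulr0.
Qed.

Lemma frame_col_fix r (Q : 'M[R]_n) (E : 'M[R]_(n, r)) i :
  E^T *m E = 1%:M -> E *m E^T = Q -> Q *m col i E = col i E.
Proof. by move=> EE EQ; rewrite !colE -EQ mulmxA -[E *m E^T *m E]mulmxA EE mulmx1. Qed.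

(** The eigenvalues on Ran P are negative and the others positive, so the sorted list [lam] is the
    former, sorted, followed by the latter: its first k entries are exactly the eigenvalues on Ran
    P. *)
Lemma lowest_invariant_projector :
  P *m H = H *m P ->
  (forall (v : 'cV[R]_n) a, P *m v = v -> H *m v = a *: v -> v != 0 -> a < 0) ->
  (forall (v : 'cV[R]_n) a, (Pi - P) *m v = v -> H *m v = a *: v -> v != 0 -> 0 < a) ->
  count (fun a => a < 0) lam = k /\
  is_orthoproj (first_invariant_subspace S H lam k) P.
Proof.
move=> PH neg pos.
have [E [mu [r [F [nu [[EE EP HE] [FF FQ HF [_ lamE]]]]]]]] :=
  eigen_split Pit PiPi rPi Pt PP rP PiP Ht PiH PH lamH.
have mu0 i : mu 0 i < 0.
  apply: (neg (col i E)); [exact: frame_col_fix|exact: col_eigen|exact: frame_col_neq0].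
have nu0 i : 0 < nu 0 i.
  apply: (pos (col i F)); [exact: frame_col_fix|exact: col_eigen|exact: frame_col_neq0].
pose mus := [seq mu 0 i | i : 'I_k]; pose nus := [seq nu 0 i | i : 'I_r].
have smus : size mus = k by rewrite size_map size_enum_ord.
have mus0 : all (fun a => a < 0) mus by apply/allP => _ /mapP[i _ ->].
have nus0 : all (fun a => 0 < a) nus by apply/allP => _ /mapP[i _ ->].
have lam_lt0 : count (fun a => a < 0) lam = k.
  by rewrite (seq.permP lamE); exact: count_neg_split.
split=> //; split=> //.
have lamE' : lam = sort <=%R mus ++ sort <=%R nus :> seq R.
  apply: le_sorted_eq => //; last first.
    apply: (perm_trans lamE); rewrite perm_sym.
    by apply: perm_cat; rewrite perm_sort.
  rewrite sorted_pairwise; last exact: le_trans.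
  rewrite pairwise_cat -!sorted_pairwise; try exact: le_trans.
  rewrite !sort_le_sorted !andbT; apply/allrelP => x y; rewrite !mem_sort.
  by move=> /(allP mus0) x0 /(allP nus0) y0; exact/ltW/(lt_trans x0 y0).
have lamk i : (i < k)%N -> lam`_i = (sort <=%R mus)`_i.
  by move=> ik; rewrite lamE' nth_cat size_sort smus ik.
apply/seteqP; split => [v [w _ <-]|v [u [uS ->]]].
  (* [lam] lists the eigenvalues in increasing order, the columns of E do not; the permutation p
     matches the two. *)
  pose mut : k.-tuple R := [tuple mu 0 i | i < k].
  have [p Ep] : exists p : {perm 'I_k},
      sort <=%R mus = [tuple tnth mut (p i) | i < k] :> seq R.
    by apply/tuple_permP; rewrite perm_sort; exact: perm_refl.
  exists (fun i => (E^T *m w) (p i) 0 *: col (p i) E); split => [i|].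
    split; first by apply/SE; rewrite -scalemxAr -(frame_col_fix (p i) EE EP) mulmxA PiP.
    rewrite -scalemxAr (col_eigen _ HE) lamk// Ep.
    rewrite (nth_map i) ?size_enum_ord// nth_ord_enum tnth_mktuple.
    by rewrite !scalerA mulrC.
  rewrite [RHS](_ : _ = \sum_i (E^T *m w) i 0 *: col i E); last first.
    by rewrite [RHS](reindex_inj (@perm_inj _ p)).
  rewrite -EP -mulmxA; apply/colP => j.
  rewrite !mxE summxE; apply: eq_bigr => i _.
  by rewrite !mxE mulrC.
exists (\sum_i u i) => //; rewrite mulmx_sumr; apply: eq_bigr => i _.
(* If nonzero, the component of [u i] outside Ran P would be an eigenvector in Ran (Pi - P) with a
   negative eigenvalue, against [pos]. *)
have [/SE Su Hu] := uS i; apply/eqP; rewrite -subr_eq0; apply: contraTT isT => N.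
have /pos : (Pi - P) *m (u i - P *m u i) = u i - P *m u i.
  rewrite mulmxBr !mulmxBl Su mulmxA PiP mulmxA PP subrr subr0//.
have HN : H *m (u i - P *m u i) = lam`_i *: (u i - P *m u i).
  by rewrite mulmxBr mulmxA -PH -mulmxA Hu -scalemxAr scalerBr.
move/(_ _ HN); rewrite -oppr_eq0 opprB N => /(_ isT).
by rewrite ltNge ltW// (sorted_count_neg lam_sorted lam_lt0).
Qed.

(** Ran P is a sum of eigenvectors, hence stable under H, and symmetry turns P H P = H P into
    commutation. The list [lam'] is a permutation of [lam], so the count of negative entries
    transfers. *)
Lemma lowest_invariant_splitting (lam' : d.-tuple R) :
  nondegenerate_on S H ->
  has_eigenvalues S (mulmx H) lam' -> count (fun a => a < 0) lam' = k ->
  is_orthoproj (first_invariant_subspace S H lam k) P ->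
  P *m H = H *m P /\
  exists (E : 'M[R]_(n, k)) (mu : 'rV[R]_k) (r : nat) (F : 'M[R]_(n, r)) (nu : 'rV[R]_r),
  [/\ E^T *m E = 1%:M, E *m E^T = P, H *m E = E *m diag_mx mu & forall i, mu 0 i < 0] /\
  [/\ F^T *m F = 1%:M, F *m F^T = Pi - P, H *m F = F *m diag_mx nu &
    forall i, 0 < nu 0 i].
Proof.
move=> nondeg lamH' lam'k [_ _ PS].
have lamk : count (fun a => a < 0) lam = k.
  by rewrite -lam'k; apply/seq.permP; exact: has_eigenvalues_perm lamH lamH'.
have HPS (v : 'cV[R]_n) : P *m (H *m (P *m v)) = H *m (P *m v).
  have [u [uS uE]] : first_invariant_subspace S H lam k (P *m v).
    by rewrite -PS; exists v.
  have : first_invariant_subspace S H lam k (H *m (P *m v)).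
    exists (fun i : 'I_k => lam`_i *: u i); split.
      move=> i; have [/SE Su Hu] := uS i; split.
        by apply/SE; rewrite -scalemxAr Su.
      by rewrite -scalemxAr Hu.
    by rewrite uE mulmx_sumr; apply: eq_bigr => i _; have [_] := uS i.
  by rewrite -PS => -[w _ <-]; rewrite mulmxA PP.
have PHP : P *m H *m P = H *m P.
  apply/matrixP => i j; have /colP/(_ i) := HPS (delta_mx j 0).
  by rewrite !mulmxA -!colE !mxE.
have PH : P *m H = H *m P.
  by rewrite -PHP -{1}Pt -{1}Ht -trmx_mul -PHP !trmx_mul Pt Ht mulmxA.
split=> //.
have [E [mu [r [F [nu [[EE EP HE] [FF FQ HF [_ lamE]]]]]]]] :=
  eigen_split Pit PiPi rPi Pt PP rP PiP Ht PiH PH lamH.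
(* A column e of E with eigenvalue at least 0 would be orthogonal to the eigenvectors for the first
   k, negative, entries of [lam]; but e is a sum of such vectors, so e^T e = 0. *)
have mu0 j : mu 0 j < 0.
  rewrite ltNge; apply/negP => muj.
  have := frame_col_fix j EE EP; set e := col j E => eP.
  have [u [uS uE]] : first_invariant_subspace S H lam k e by rewrite -PS; exists e.
  have : e != 0 by exact: frame_col_neq0.
  move/eqP; apply; apply: tr_mulmx_eq0; rewrite {2}uE mulmx_sumr big1// => i _.
  have [Su Hu] := uS i; have He : H *m e = mu 0 j *: e by exact: col_eigen.
  have li : lam`_i < 0 := sorted_count_neg lam_sorted lamk (ltn_ord i).
  have E1 : e^T *m (H *m u i) = lam`_i *: (e^T *m u i) by rewrite Hu -scalemxAr.
  have E2 : e^T *m (H *m u i) = mu 0 j *: (e^T *m u i).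
    by rewrite mulmxA -{1}Ht -trmx_mul He linearZ/= -scalemxAl.
  have : (mu 0 j - lam`_i) *: (e^T *m u i) = 0 by rewrite scalerBl -E1 -E2 subrr.
  move/eqP; rewrite scaler_eq0 => /orP[|/eqP//].
  by rewrite subr_eq0 gt_eqF// (lt_le_trans li muj).
exists E, mu, r, F, nu; split; split=> // i.
(* The k eigenvalues on Ran P already exhaust the negative entries of [lam]; the value 0 is excluded
   afterwards by nondegeneracy. *)
have nuge0 : ~~ (nu 0 i < 0).
  have : has (fun a => a < 0) [seq nu 0 i | i : 'I_r] = false.
    apply/negbTE; rewrite has_count -leqNgt leqn0; move: lamk.
    rewrite (seq.permP lamE) count_cat.
    rewrite (_ : count _ [seq mu 0 i | i : 'I_k] = k); last first.
      rewrite -[RHS](_ : size [seq mu 0 i | i : 'I_k] = k); last first.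
        by rewrite size_map size_enum_ord.
      by apply/eqP; rewrite -all_count; apply/allP => _ /mapP[l _ ->].
    by move=> /eqP; rewrite -{2}[k]addn0 eqn_add2l.
  move/negbT/hasPn => /(_ (nu 0 i)); apply.
  by apply/mapP; exists i => //; rewrite mem_enum.
rewrite lt0r leNgt nuge0 andbT; apply/eqP => nui.
have /eqP := frame_col_neq0 i FF; apply; apply: nondeg.
  apply/SE; have := frame_col_fix i FF FQ => {1}<-; rewrite mulmxA mulmxBr PiPi PiP.
  exact: frame_col_fix.
by rewrite (col_eigen _ HF) nui scale0r.
Qed.

End LowestSubspace.

(** * Commutators with a projector *)

Section Commutators.
Context {R : realType} {n : nat}.

Lemma idem_sandwich0 (P Om : 'M[R]_n) : P *m P = P -> P *m Om + Om *m P = Om ->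
  P *m Om *m P = 0.
Proof.
move=> PP /(congr1 (fun A => P *m A *m P))/eqP.
rewrite mulmxDr mulmxDl !mulmxA PP -[P *m Om *m P *m P]mulmxA PP.
by rewrite -subr_eq0 addrK => /eqP.
Qed.

(** [P, [P, H]] = P H - 2 P H P + H P consists of the off-diagonal blocks of H relative to P, which
    vanish exactly when P and H commute. *)
Lemma commutator_comm (P H : 'M[R]_n) : P *m P = P ->
  commutator P (commutator P H) = 0 <-> P *m H = H *m P.
Proof.
move=> PP; split=> [E|E]; last by rewrite /commutator E subrr mulmx0 mul0mx subrr.
have E0 : P *m H - P *m H *m P - (P *m H *m P - H *m P) = 0.
  rewrite -[RHS]E /commutator mulmxBr mulmxBl !mulmxA PP.
  by rewrite -[H *m P *m P]mulmxA PP.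
have E1 : P *m H = P *m H *m P.
  have := congr1 (mulmx P) E0; rewrite mulmx0 !mulmxBr !mulmxA PP subrr subr0.
  by move/eqP; rewrite subr_eq0 => /eqP.
by move: E0; rewrite E1 -[P *m H *m P *m P]mulmxA PP subrr sub0r opprB => /subr0_eq.
Qed.

Lemma commutatorDr (A B C : 'M[R]_n) :
  commutator A (B + C) = commutator A B + commutator A C.
Proof. by rewrite /commutator mulmxDl mulmxDr opprD addrACA. Qed.

Lemma commutatorDl (A B C : 'M[R]_n) :
  commutator (A + B) C = commutator A C + commutator B C.
Proof. by rewrite /commutator mulmxDl mulmxDr opprD addrACA. Qed.

(* The motion of the tangent spaces along u, with K = D Pi(x)[u], does not
   contribute to the vertical part of the differential of the field. *)
Lemma lift_drift (T P H K X : 'M[R]_n) :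
  T *m K *m T = 0 -> T *m P = P -> P *m T = P -> T *m H = H -> H *m T = H ->
  P *m H = H *m P ->
  commutator (K *m P + P *m K) H + commutator P (K *m H + X + H *m K) = commutator P X.
Proof.
move=> TKT TP PT TH HT PH.
(* T K T = 0 kills K between any two operators carried by T; the four remaining terms cancel because
   P H = H P. *)
have PKH : P *m K *m H = 0.
  have -> : P *m K *m H = P *m (T *m K *m T) *m H; last by rewrite TKT mulmx0 mul0mx.
  by rewrite !mulmxA PT -[P *m K *m T *m H]mulmxA TH.
have HKP : H *m K *m P = 0.
  have -> : H *m K *m P = H *m (T *m K *m T) *m P; last by rewrite TKT mulmx0 mul0mx.
  by rewrite !mulmxA HT -[H *m K *m T *m P]mulmxA TP.
rewrite [K *m H + X + _]addrAC commutatorDr addrA.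
rewrite -[RHS]add0r; congr (_ + _).
rewrite /commutator !mulmxDl !mulmxDr !mulmxA PKH HKP !addr0 !add0r.
by rewrite -[K *m H *m P]mulmxA -PH mulmxA addrA subrK subrr.
Qed.

Lemma double_commutator (P X : 'M[R]_n) : P *m P = P ->
  commutator P (commutator P X) = P *m X - P *m X *m P - (P *m X *m P - X *m P).
Proof.
move=> PP; rewrite /commutator mulmxBr mulmxBl !mulmxA PP.
by rewrite -[X *m P *m P]mulmxA PP.
Qed.

End Commutators.

(** * Slice charts *)

Section Jacobian.
Context {R : realType} (n d : nat) (dn : (d <= n)%N).

Definition slice_dir (j : 'I_d) : 'cV[R]_n := delta_mx (widen_ord dn j) 0.

Definition slice_incl : 'M[R]_(n, d) := \matrix_(i, j) slice_dir j i 0.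

Lemma slice_inclE (a : 'cV[R]_d) : slice_incl *m a = \sum_j a j 0 *: slice_dir j.
Proof.
apply/colP => i; rewrite mxE summxE; apply: eq_bigr => j _.
by rewrite !mxE mulrC.
Qed.

Lemma slice_inclK : slice_incl^T *m slice_incl = 1%:M.
Proof.
apply/matrixP => i j; rewrite !mxE (bigD1 (widen_ord dn i))//= !mxE !eqxx !andbT mul1r.
rewrite big1 ?addr0 => [|l li]; last by rewrite !mxE (negbTE li) mul0r.
by rewrite -val_eqE/= val_eqE.
Qed.

Lemma slice_incl_tail (a : 'cV[R]_d) (i : 'I_n) : (d <= i)%N -> (slice_incl *m a) i 0 = 0.
Proof.
move=> di; rewrite mxE big1// => j _; rewrite !mxE andbT -val_eqE/=.
by rewrite gtn_eqF ?mul0r//; exact: leq_trans (ltn_ord j) di.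
Qed.

Lemma slice_incl_proj (z : 'cV[R]_n) :
  (forall i : 'I_n, (d <= i)%N -> z i 0 = 0) -> z = slice_incl *m (slice_incl^T *m z).
Proof.
move=> z0; apply/colP => i; have [id|di] := ltnP i d; last first.
  by rewrite z0// slice_incl_tail.
rewrite mxE (bigD1 (Ordinal id))//= big1 ?addr0 => [|j ji]; last first.
  rewrite !mxE andbT (_ : (i == widen_ord dn j) = false) ?mul0r//.
  by apply: contraNF ji => /eqP ij; apply/eqP/val_inj; rewrite /= ij.
rewrite !mxE andbT -val_eqE/= eqxx mul1r (bigD1 i)//= big1 ?addr0 => [|j ji]; last first.
  by rewrite !mxE andbT -val_eqE/= val_eqE (negbTE ji) mul0r.
by rewrite !mxE andbT -val_eqE/= eqxx mul1r.
Qed.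

(** The chart coordinate ranges over an open set of R^n, but only the first d directions are tangent
    to the image of M, so only those columns are kept. *)
Definition slice_jacobian m (F : 'cV[R]_n -> 'cV[R]_m) (z : 'cV[R]_n) : 'M[R]_(m, d) :=
  \matrix_(i, j) 'D_(slice_dir j) F z i 0.

Lemma slice_jacobianE m (F : 'cV[R]_n -> 'cV[R]_m) z a :
  differentiable F z -> slice_jacobian F z *m a = 'd F z (slice_incl *m a).
Proof.
move=> dF; rewrite slice_inclE linear_sum; apply/colP => i.
rewrite mxE summxE; apply: eq_bigr => j _.
by rewrite linearZ mxE [RHS]mxE deriveE// mulrC.
Qed.

Lemma Ck_slice_jacobian m r (V : set 'cV[R]_n) (F : 'cV[R]_n -> 'cV[R]_m) :
  open V -> Ck_on r.+1 V F -> Ck_on r V (slice_jacobian F).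
Proof.
move=> oV [_ DF]; apply/(Ck_mxP _ _ oV) => i j; under eq_fun do rewrite mxE.
by move/(Ck_mxP _ _ oV): (DF (slice_dir j)); apply.
Qed.

End Jacobian.

(** * Calculus with values in a product space *)

Section Pairs.
Context {R : realType} {W W' : normedModType R}.

Lemma derive_pair (V : normedModType R) (f : V -> W) (g : V -> W') x v :
  differentiable f x -> differentiable g x ->
  'D_v (fun y => (f y, g y)) x = ('D_v f x, 'D_v g x).
Proof.
move=> df dg; rewrite !deriveE//; last exact: differentiable_pair.
by rewrite diff_pair.
Qed.

Lemma Ck_pair (V : normedModType R) r (U : set V) (f : V -> W) (g : V -> W') : open U ->
  Ck_on r U f -> Ck_on r U g -> Ck_on r U (fun y => (f y, g y)).
Proof.
move=> oU; elim: r f g => [|r IH] f g.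
  by move=> cf cg x Ux; apply: cvg_pair; [exact: cf|exact: cg].
move=> [df Df] [dg Dg]; split=> [x Ux|v].
  exact: differentiable_pair (df x Ux) (dg x Ux).
apply: (Ck_ext oU) (IH _ _ (Df v) (Dg v)) => x Ux.
by rewrite derive_pair//; [exact: df|exact: dg].
Qed.

Lemma is_derive_pairP (F : R -> W * W') (t : R) u D :
  is_derive t 1 F (u, D) <->
  is_derive t 1 (fun s => (F s).1) u /\ is_derive t 1 (fun s => (F s).2) D.
Proof.
have cfst : continuous (fst : W * W' -> W) by move=> y; exact: cvg_fst.
have csnd : continuous (snd : W * W' -> W') by move=> y; exact: cvg_snd.
split=> [[dF FE]|[[d1 <-] [d2 <-]]].
  have DF : differentiable F t by exact/derivable1_diffP.
  split; apply: DeriveDef.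
  - apply/derivable1_diffP.
    exact: (differentiable_comp DF
      (@linear_differentiable _ _ _ (fst : {linear (W * W')%type -> W}) (F t) cfst)).
  - by rewrite (derive_linear (l := fst : {linear (W * W')%type -> W}))// FE.
  - apply/derivable1_diffP.
    exact: (differentiable_comp DF
      (@linear_differentiable _ _ _ (snd : {linear (W * W')%type -> W'}) (F t) csnd)).
  - by rewrite (derive_linear (l := snd : {linear (W * W')%type -> W'}))// FE.
have D1 := (derivable1_diffP _ _).1 d1; have D2 := (derivable1_diffP _ _).1 d2.
rewrite (_ : F = fun s => ((F s).1, (F s).2)); last by apply/funext => s; case: (F s).
apply: DeriveDef; first exact/diff_derivable/differentiable_pair.
by rewrite derive_pair.
Qed.

Lemma is_derive_scale p q (a : R -> R) (A : R -> 'M[R]_(p, q)) (t : R) da dA :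
  is_derive t 1 a da -> is_derive t 1 A dA ->
  is_derive t 1 (fun s => a s *: A s) (da *: A t + a t *: dA).
Proof.
move=> Ha /is_derive_mxP HA; apply/is_derive_mxP => i j.
rewrite (_ : (fun _ => _) = a * (fun s => A s i j)); last first.
  by apply/funext => s; rewrite mxE.
apply: is_derive_eq (is_deriveM Ha (HA i j)) _.
by rewrite !mxE addrC; congr (_ + _); exact: mulrC.
Qed.

End Pairs.

Lemma Ck_colproj (R : realType) (V : normedModType R) p q r (U : set V) (F : V -> 'M[R]_(p, q)) :
  open U -> (forall x, U x -> (F x)^T *m F x \in unitmx) -> Ck_on r U F ->
  Ck_on r U (fun x => colproj (F x)).
Proof.
move=> oU uF CF; have Ct := Ck_trmx oU CF.
do 2?[apply: Ck_mulmx => //]; apply: Ck_invmx => //; exact: Ck_mulmx.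
Qed.

Lemma is_derive_commutator (R : realType) p (A B : R -> 'M[R]_p) (t : R) dA dB :
  is_derive t 1 A dA -> is_derive t 1 B dB ->
  is_derive t 1 (fun s => commutator (A s) (B s)) (commutator dA (B t) + commutator (A t) dB).
Proof.
move=> DA DB; apply: is_derive_eq.
  exact: is_deriveB (is_derive_mulmx DA DB) (is_derive_mulmx DB DA).
rewrite /commutator opprD addrACA [X in _ + X = _]addrC -!addrA.
by congr (_ + _); rewrite addrCA; congr (_ + _); rewrite addrC.
Qed.

(** * Derivatives along curves in a set *)

Section Curves.
Context {R : realType}.

Lemma curve_throughP (V : normedModType R) (N : set V) x v c :
  curve_through N x v c ->
  [/\ c 0 = x, is_derive (0 : R) 1 c v & \forall t \near (0 : R), N (c t)].
Proof.
move=> [[e e0 [Nc sc]] c0 cv].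
have dc : differentiable c 0 by apply: (Ck_differentiable (sc 1%N)); exact: ballxx.
split=> //; last by apply/nbhs_ballP; exists e.
by apply: DeriveDef; [exact: diff_derivable|rewrite -derive1E].
Qed.

Lemma is_derive_uniq (X W : normedModType R) (F : X -> W) t v D D' :
  is_derive t v F D -> is_derive t v F D' -> D = D'.
Proof. by move=> [_ <-] [_ <-]. Qed.

Lemma derive1_val (W : normedModType R) (F : R -> W) (t : R) D :
  is_derive t 1 F D -> derive1 F t = D.
Proof. by move=> [_ <-]; rewrite derive1E. Qed.

(** The curve chosen by [mdiff] is unknown, so the derivative must be D along every admissible one;
    tangency of v ensures that the choice is not the default constant curve. *)
Lemma mdiff_curve (V W : normedModType R) (N : set V) (F : V -> W) x v D :
  tangent N x v ->
  (forall c, curve_through N x v c -> is_derive (0 : R) 1 (fun t => F (c t)) D) ->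
  mdiff N F x v = D.
Proof.
move=> [c0 c0P] H; rewrite /mdiff; apply: derive1_val; apply: H.
by apply: xgetPex; exists c0.
Qed.

End Curves.

(** * Tangent spaces and projectors read in a slice chart *)

Section Chart.
Context {R : realType} (n d : nat) (dn : (d <= n)%N) (M U V : set 'cV[R]_n)
  (phi psi : 'cV[R]_n -> 'cV[R]_n).
Hypotheses (oU : open U) (oV : open V) (Sphi : smooth_on U phi) (Spsi : smooth_on V psi)
  (phiK : forall y, U y -> V (phi y) /\ psi (phi y) = y)
  (psiK : forall z, V z -> U (psi z) /\ phi (psi z) = z)
  (MU : forall y, U y -> (M y <-> forall i : 'I_n, (d <= i)%N -> phi y i 0 = 0)).

Local Notation J := (@slice_incl R n d dn).

(* All objects of M are read as functions of the chart coordinate z = phi x, in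
   which they are C^k on the open set V: the columns of [frame z] span the tangent
   space at psi z, [coframe z] gives the coordinates of a tangent vector in that
   basis, and [tproj], [grad], [hess] below are the values at psi z of the
   tangent projector, of the Riemannian gradient and of the Hessian. *)
Definition frame z := slice_jacobian dn psi z.
Definition coframe z := invmx ((frame z)^T *m frame z) *m (frame z)^T.
Definition tproj z := colproj (frame z).

Lemma dpsi z : V z -> differentiable psi z.
Proof. exact: Ck_differentiable (Spsi 1%N). Qed.

Lemma dphi x : U x -> differentiable phi x.
Proof. exact: Ck_differentiable (Sphi 1%N). Qed.

Lemma frameE z a : V z -> frame z *m a = 'd psi z (J *m a).
Proof. by move=> Vz; rewrite slice_jacobianE//; exact: dpsi. Qed.

(** Chain rule for phi o psi = id on V. *)
Lemma phi_frame z a : V z -> 'd phi (psi z) (frame z *m a) = J *m a.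
Proof.
move=> Vz; have [Uz pz] := psiK Vz; rewrite frameE//.
have D1 : is_derive z (J *m a) (fun y => phi (psi y)) ('d phi (psi z) ('d psi z (J *m a))).
  apply: (is_derive_comp (dpsi Vz)); last exact: dphi.
  by rewrite -deriveE; [exact/derivableP/diff_derivable/dpsi|exact: dpsi].
have D2 : is_derive z (J *m a) (fun y => phi (psi y)) (J *m a).
  apply: (@near_eq_is_derive _ _ _ id) => //.
  by apply: (near_open oV Vz) => y Vy; have [_ ->] := psiK Vy.
by rewrite -[LHS](@derive_val _ _ _ _ _ _ _ D1) (@derive_val _ _ _ _ _ _ _ D2).
Qed.

Lemma frame_inj z (a : 'cV[R]_d) : V z -> frame z *m a = 0 -> a = 0.
Proof.
move=> Vz /(congr1 ('d phi (psi z))); rewrite phi_frame// linear0.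
by move/(congr1 (mulmx J^T)); rewrite mulmxA slice_inclK mul1mx mulmx0.
Qed.

Lemma gram_frame z : V z -> (frame z)^T *m frame z \in unitmx.
Proof. by move=> Vz; apply: gram_unitmx => a; exact: frame_inj. Qed.

Lemma coframeK z : V z -> coframe z *m frame z = 1%:M.
Proof. by move=> Vz; rewrite -mulmxA mulVmx// gram_frame. Qed.

Lemma tprojE z : tproj z = frame z *m coframe z.
Proof. by rewrite /tproj /colproj mulmxA. Qed.

Lemma tproj_sym z : (tproj z)^T = tproj z.
Proof. exact: colproj_sym. Qed.

Lemma tproj_idem z : V z -> tproj z *m tproj z = tproj z.
Proof. by move=> Vz; apply: colproj_idem; exact: gram_frame. Qed.

Lemma tproj_frame z : V z -> tproj z *m frame z = frame z.
Proof. by move=> Vz; apply: colprojK; exact: gram_frame. Qed.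

Lemma coframe_tproj z : V z -> coframe z *m tproj z = coframe z.
Proof. by move=> Vz; rewrite tprojE mulmxA coframeK// mul1mx. Qed.

Lemma tr_coframe z : (coframe z)^T = frame z *m invmx ((frame z)^T *m frame z).
Proof. by rewrite trmx_mul trmxK gram_inv_sym. Qed.

Lemma tproj_tr_coframe z : V z -> tproj z *m (coframe z)^T = (coframe z)^T.
Proof. by move=> Vz; rewrite -tproj_sym -trmx_mul coframe_tproj. Qed.

Lemma rank_tproj z : V z -> \rank (tproj z) = d.
Proof.
move=> Vz; apply/eqP; rewrite eqn_leq; apply/andP; split.
  by rewrite tprojE; apply: leq_trans (mxrankM_maxl _ _) (rank_leq_col _).
rewrite -{1}(mxrank1 R d) -(coframeK Vz) -(tproj_frame Vz).
by apply: leq_trans (mxrankM_maxr _ _) _; exact: mxrankM_maxl.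
Qed.

(** Near 0 the last n - d coordinates of phi o c vanish, so its velocity lies in the slice; applying
    D psi recovers v. *)
Lemma curve_in_chart x (c : R -> 'cV[R]_n) v : U x -> c 0 = x ->
  is_derive (0 : R) 1 c v -> (\forall t \near (0 : R), M (c t)) ->
  exists2 a, v = frame (phi x) *m a & is_derive (0 : R) 1 (fun t => phi (c t)) (J *m a).
Proof.
move=> Ux c0 Dc Mc.
have dc : differentiable c 0 by apply/derivable1_diffP; case: Dc.
have Uc : \forall t \near (0 : R), U (c t).
  apply: (differentiable_continuous dc); rewrite c0; exact: open_nbhs_nbhs.
have dphix : differentiable phi (c 0) by rewrite c0; exact: dphi.
have Dz := is_derive_comp dc Dc dphix; rewrite c0 in Dz.
have [Vx px] := phiK Ux.
have zE : 'd phi x v = J *m (J^T *m 'd phi x v).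
  apply: slice_incl_proj => i di.
  have [_ <-] := (is_derive_mxP _ _ _ _).1 Dz i 0.
  rewrite (@near_eq_derive _ _ _ _ (cst 0)) ?derive_cst//.
  by near=> t; apply: ((MU _).1 _ i di); near: t.
exists (J^T *m 'd phi x v); last by rewrite -zE.
rewrite frameE// -zE.
have dz : differentiable (fun t => phi (c t)) 0 by exact: (differentiable_comp dc dphix).
have dpsix : differentiable psi (phi (c 0)) by rewrite c0; exact: dpsi.
have Dpz := is_derive_comp dz Dz dpsix; rewrite c0 in Dpz.
have Dc' : is_derive (0 : R) 1 (fun t => psi (phi (c t))) v.
  apply: near_eq_is_derive Dc; near=> t.
  by have [|_ ->] := @phiK (c t); first by near: t.
by have [_ <-] := Dpz; have [_ ->] := Dc'.
Unshelve. all: by end_near. Qed.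

Lemma Ck_slice_line z (a : 'cV[R]_d) : V z -> exists2 e : R, 0 < e &
  (forall t, ball (0 : R) e t -> V (z + t *: (J *m a))) /\
  forall r, Ck_on r (ball (0 : R) e) (fun t => z + t *: (J *m a)).
Proof.
move=> Vz.
have : \forall t \near (0 : R), V (z + t *: (J *m a)).
  apply: (differentiable_continuous (differentiable_line z (J *m a) 0)).
  by rewrite scale0r addr0; exact: open_nbhs_nbhs.
move=> /nbhs_ballP[e e0 He]; exists e => //; split; first exact: He.
move=> s; apply: Ck_add; [exact: ball_open|exact: Ck_cst|].
by apply: (@Ck_linear _ _ _ _ _ (@scalel R _ (J *m a))); exact: scalel_continuous.
Qed.

Lemma chart_M z : V z -> (forall i : 'I_n, (d <= i)%N -> z i 0 = 0) -> M (psi z).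
Proof. by move=> Vz z0; have [Uz pz] := psiK Vz; apply/(MU Uz); rewrite pz. Qed.

Lemma phi_tail x : U x -> M x -> forall i : 'I_n, (d <= i)%N -> phi x i 0 = 0.
Proof. by move=> Ux /(MU Ux). Qed.

(** Velocities lie in the span of the frame by [curve_in_chart]; conversely psi maps straight lines
    of the slice to curves of M with any prescribed velocity in that span. *)
Lemma tangentE x : U x -> M x ->
  tangent M x = range (mulmx (frame (phi x)) : 'cV_d -> 'cV_n).
Proof.
move=> Ux Mx; have [Vx px] := phiK Ux; apply/seteqP; split=> [v [c]|_ [a _ <-]].
  move=> /curve_throughP[c0 Dc Mc].
  by have [a -> _] := curve_in_chart Ux c0 Dc Mc; exists a.
have [e e0 [Ve Se]] := Ck_slice_line a Vx.
exists (fun t => psi (phi x + t *: (J *m a))); split.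
- exists e => //; split=> [t te|r].
    apply: chart_M => [|i di]; first exact: Ve.
    by rewrite mxE [X in _ + X]mxE slice_incl_tail// mulr0 addr0 phi_tail.
  exact: (Ck_comp (ball_open _ _) oV Ve (Se r) (Spsi r)).
- by rewrite scale0r addr0.
- rewrite frameE//; apply: derive1_val.
  have := @is_derive_along_line _ _ _ psi (phi x) (J *m a) 0.
  by rewrite scale0r addr0 -deriveE; [apply; exact: dpsi|exact: dpsi].
Qed.

Lemma proj_tangentE x : U x -> M x -> proj_tangent M x = tproj (phi x).
Proof.
move=> Ux Mx; have [Vx px] := phiK Ux.
have T : is_orthoproj (tangent M x) (tproj (phi x)).
  by rewrite tangentE//; apply: colproj_orthoproj; exact: gram_frame.
rewrite /proj_tangent.
by apply: (orthoproj_uniq _ T); exact: (xgetPex 0 (ex_intro _ _ T)).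
Qed.

(** F is only controlled on M, so the chain rule is applied to [Fh]; near 0 the curve stays in M and
    U, where F o c = Fh o phi o c. *)
Lemma is_derive_chart (W : normedModType R) (F Fh : 'cV[R]_n -> W) x c v :
  U x -> M x -> (forall y, U y -> M y -> F y = Fh (phi y)) ->
  differentiable Fh (phi x) -> c 0 = x -> is_derive (0 : R) 1 c v ->
  (\forall t \near (0 : R), M (c t)) ->
  is_derive (0 : R) 1 (fun t => F (c t)) ('d Fh (phi x) (J *m (coframe (phi x) *m v))).
Proof.
move=> Ux Mx FE dF c0 Dc Mc; have [Vx px] := phiK Ux.
have [a -> Dz] := curve_in_chart Ux c0 Dc Mc.
have dc : differentiable c 0 by apply/derivable1_diffP; case: Dc.
have Uc : \forall t \near (0 : R), U (c t).
  apply: (differentiable_continuous dc); rewrite c0; exact: open_nbhs_nbhs.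
have dz : differentiable (fun t => phi (c t)) 0 by apply/derivable1_diffP; case: Dz.
rewrite [coframe _ *m _]mulmxA coframeK// mul1mx.
have dF' : differentiable Fh (phi (c 0)) by rewrite c0.
have := is_derive_comp dz Dz dF'; rewrite c0.
apply: near_eq_is_derive; near=> t.
by rewrite -FE//; near: t.
Unshelve. all: by end_near. Qed.

Lemma mdiff_chart (W : normedModType R) (F Fh : 'cV[R]_n -> W) x v :
  U x -> M x -> (forall y, U y -> M y -> F y = Fh (phi y)) ->
  differentiable Fh (phi x) -> tangent M x v ->
  mdiff M F x v = 'd Fh (phi x) (J *m (coframe (phi x) *m v)).
Proof.
move=> Ux Mx FE dF Tv; apply: mdiff_curve => // c /curve_throughP[c0 Dc Mc].
exact: is_derive_chart.
Qed.

Lemma Ck_frame r : Ck_on r V frame.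
Proof. by apply: Ck_slice_jacobian => //; exact: Spsi. Qed.

Lemma Ck_coframe r : Ck_on r V coframe.
Proof.
have Cf := Ck_frame r; have Ct := Ck_trmx oV Cf.
apply: Ck_mulmx => //; apply: Ck_invmx => //; last exact: Ck_mulmx.
by move=> z; exact: gram_frame.
Qed.

Lemma Ck_tproj r : Ck_on r V tproj.
Proof.
rewrite (_ : tproj = fun z => frame z *m coframe z).
  by apply: Ck_mulmx => //; [exact: Ck_frame|exact: Ck_coframe].
by apply/funext => z; rewrite tprojE.
Qed.

(** * Riemannian gradient and Hessian in the chart *)

Section Function.
Context (f : 'cV[R]_n -> R).
Hypothesis f_C3 : Ck_on 3 setT f.

Definition cgrad (z : 'cV[R]_n) : 'cV[R]_d := \col_j 'D_(slice_dir dn j) (fun y => f (psi y)) z.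
(** The classical inverse metric formula: by [tr_coframe] this is the frame applied to the inverse
    Gram matrix times the coordinate derivatives of f. *)
Definition grad z : 'cV[R]_n := (coframe z)^T *m cgrad z.
Definition dgrad z := slice_jacobian dn grad z.
(** The coframe kills normal vectors, which produces the extension by zero. *)
Definition hess z : 'M[R]_n := tproj z *m dgrad z *m coframe z.

Lemma Ck_fpsi : Ck_on 3 V (fun y => f (psi y)).
Proof.
by apply: (Ck_comp_scalar oV (@openT _) (fun _ _ => I)) => //; exact: Spsi.
Qed.

Lemma Ck_cgrad : Ck_on 2 V cgrad.
Proof.
apply/(Ck_mxP _ _ oV) => i j; under eq_fun do rewrite mxE.
by have [_] := Ck_fpsi; apply.
Qed.

Lemma Ck_grad : Ck_on 2 V grad.
Proof.
by apply: Ck_mulmx => //; [apply: Ck_trmx => //; exact: Ck_coframe|exact: Ck_cgrad].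
Qed.

Lemma Ck_hess : Ck_on 1 V hess.
Proof.
apply: Ck_mulmx => //; last exact: Ck_coframe.
apply: Ck_mulmx => //; first exact: Ck_tproj.
by apply: Ck_slice_jacobian => //; exact: Ck_grad.
Qed.

Lemma cgradE z a : V z -> (cgrad z)^T *m a = ('d (fun y => f (psi y)) z (J *m a))%:M.
Proof.
move=> Vz; have df := Ck_differentiable Ck_fpsi Vz.
rewrite slice_inclE linear_sum; apply/matrixP => i j; rewrite !ord1 !mxE mulr1n.
by apply: eq_bigr => l _; rewrite linearZ !mxE deriveE// mulrC.
Qed.

(** The defining property determines the gradient: the difference of two candidates is tangent and
    orthogonal to all tangent vectors, itself included. *)
Lemma rgradE x : U x -> M x -> rgrad M f x = grad (phi x).
Proof.
move=> Ux Mx; have [Vx px] := phiK Ux.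
have dmf v : tangent M x v -> mdiff M f x v =
    'd (fun y => f (psi y)) (phi x) (J *m (coframe (phi x) *m v)).
  apply: (mdiff_chart (Fh := fun y => f (psi y))) => //.
    by move=> y Uy _; have [_ ->] := phiK Uy.
  exact: Ck_differentiable Ck_fpsi Vx.
have TE := tangentE Ux Mx.
have gP : tangent M x (grad (phi x)) /\
    forall v, tangent M x v -> dotv (grad (phi x)) v = mdiff M f x v.
  split=> [|v Tv].
    rewrite TE; exists (invmx ((frame (phi x))^T *m frame (phi x)) *m cgrad (phi x)) => //.
    by rewrite /grad tr_coframe mulmxA.
  rewrite dmf// /dotv /grad trmx_mul trmxK -mulmxA cgradE//.
  by rewrite mxE mulr1n.
have := xgetPex 0 (ex_intro _ _ gP : exists g, [set g | tangent M x g /\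
    forall v, tangent M x v -> dotv g v = mdiff M f x v] g).
rewrite -/(rgrad M f x) => -[Tg gE]; case: gP => Tg' gE'.
apply/subr0_eq; apply: tr_mulmx_eq0; apply/matrixP => i j; rewrite !ord1 [RHS]mxE.
have Tgg : tangent M x (rgrad M f x - grad (phi x)).
  move: Tg Tg'; rewrite TE => -[a _ <-] [b _ <-]; exists (a - b) => //.
  by rewrite mulmxBr.
have Ew w : tangent M x w -> ((rgrad M f x - grad (phi x))^T *m w) 0 0 = 0.
  move=> Tw; have := gE _ Tw; rewrite -gE'// /dotv => E.
  by rewrite linearB/= mulmxBl mxE E [X in _ + X]mxE subrr.
exact: Ew.
Qed.

Lemma rhessE x : U x -> M x -> rhess M f x = hess (phi x).
Proof.
move=> Ux Mx; have [Vx px] := phiK Ux; apply/matrixP => i j.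
have dg : differentiable grad (phi x) := Ck_differentiable Ck_grad Vx.
rewrite mxE /rhess_tangent proj_tangentE//.
rewrite (mdiff_chart (Fh := grad)) //; last 2 first.
- by move=> y Uy My; exact: rgradE.
- by rewrite tangentE//; exists (coframe (phi x) *m delta_mx j 0); rewrite // tprojE mulmxA.
rewrite [coframe _ *m (_ *m _)]mulmxA coframe_tproj// -slice_jacobianE//.
by rewrite /hess !mulmxA -colE mxE.
Qed.

Lemma tproj_grad z : V z -> tproj z *m grad z = grad z.
Proof. by move=> Vz; rewrite /grad mulmxA tproj_tr_coframe. Qed.

Lemma tproj_hess z : V z -> tproj z *m hess z = hess z.
Proof.
move=> Vz; rewrite /hess; move: (tproj z) (tproj_idem Vz) (dgrad z) (coframe z) => T TT D C.
by rewrite !mulmxA TT.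
Qed.

(** Differentiating D_i (f o psi) = <frame_i, grad> in direction l gives D_l D_i (f o psi) = <D_l
    D_i psi, grad> + <frame_i, D_l grad>. Schwarz' theorem for f o psi and for the entries of psi
    makes the last term symmetric in i and l, and the Hessian is that matrix conjugated by the
    coframe. *)
Lemma hess_sym z : V z -> (hess z)^T = hess z.
Proof.
move=> Vz.
have oC i l : 'D_(slice_dir dn l) ('D_(slice_dir dn i) (fun y => f (psi y))) z =
    \sum_s ('D_(slice_dir dn l) ('D_(slice_dir dn i) (fun y => psi y s 0)) z * grad z s 0
            + frame z s i * dgrad z s l).
  have E y : V y -> 'D_(slice_dir dn i) (fun y => f (psi y)) y =
      ((frame y)^T *m grad y) i 0.
    by move=> Vy; rewrite /grad mulmxA -trmx_mul coframeK// trmx1 mul1mx mxE.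
  have -> := @near_eq_derive _ _ _ _ (fun y => ((frame y)^T *m grad y) i 0) z
    (slice_dir dn l) (near_open oV Vz E).
  have dF : differentiable frame z := Ck_differentiable (Ck_frame 1) Vz.
  have dG : differentiable grad z := Ck_differentiable Ck_grad Vz.
  have Df := derivableP (diff_derivable dF : derivable frame z (slice_dir dn l)).
  have Dg := derivableP (diff_derivable dG : derivable grad z (slice_dir dn l)).
  have [_ ->] := (is_derive_mxP _ _ _ _).1 (is_derive_mulmx (is_derive_trmx Df) Dg) i 0.
  rewrite mxE [X in X + _]mxE [X in _ + X]mxE -big_split/=; apply: eq_bigr => s _.
  rewrite !mxE; congr (_ * _ + _ * _).
  rewrite -[LHS](@derive_val _ _ _ _ _ _ _ ((is_derive_mxP _ _ _ _).1 Df s i)).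
  apply: near_eq_derive; apply: (near_open oV Vz) => y Vy.
  rewrite mxE derive_mx ?mxE//; exact/diff_derivable/dpsi.
have symBD : ((frame z)^T *m dgrad z)^T = (frame z)^T *m dgrad z.
  apply/matrixP => l i.
  have e1 := oC i l; have e2 := oC l i.
  have sw : 'D_(slice_dir dn l) ('D_(slice_dir dn i) (fun y => f (psi y))) z =
      'D_(slice_dir dn i) ('D_(slice_dir dn l) (fun y => f (psi y))) z.
    exact: (derive_comm _ _ oV (Ck_weaken Ck_fpsi) Vz).
  have swp s : 'D_(slice_dir dn l) ('D_(slice_dir dn i) (fun y => psi y s 0)) z =
      'D_(slice_dir dn i) ('D_(slice_dir dn l) (fun y => psi y s 0)) z.
    exact: (derive_comm _ _ oV ((Ck_mxP _ _ oV).1 (Spsi 2%N) s 0) Vz).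
  move: e1; rewrite sw e2 !big_split/=.
  under [X in _ = X + _]eq_bigr do rewrite swp.
  move=> /addrI H; rewrite !mxE.
  under eq_bigr do rewrite mxE; under [RHS]eq_bigr do rewrite mxE.
  by rewrite -H.
have -> : hess z = (coframe z)^T *m ((frame z)^T *m dgrad z) *m coframe z.
  by rewrite /hess [_ *m (_ *m dgrad z)]mulmxA -trmx_mul -tprojE tproj_sym.
move: ((frame z)^T *m dgrad z) symBD (coframe z) => X XX L.
by rewrite !trmx_mul XX trmxK mulmxA.
Qed.

(** * The Grassmann bundle and its tangent spaces *)

(** The operator K = D Pi along the tangent vector v; II(v, w) is [sff z v *m w]. *)
Definition sff (z v : 'cV[R]_n) : 'M[R]_n := 'd tproj z (J *m (coframe z *m v)).

Lemma differentiable_tproj z : V z -> differentiable tproj z.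
Proof. exact: Ck_differentiable (Ck_tproj 1). Qed.

Lemma sff0 z : sff z 0 = 0.
Proof. by rewrite /sff !mulmx0 linear0. Qed.

Lemma dtproj z q : V z -> is_derive z q tproj ('d tproj z q).
Proof.
move=> Vz; have D := differentiable_tproj Vz.
by rewrite -deriveE//; exact/derivableP/diff_derivable.
Qed.

Lemma sff_sym z v : V z -> (sff z v)^T = sff z v.
Proof.
move=> Vz; have D := dtproj (J *m (coframe z *m v)) Vz.
apply: is_derive_uniq D.
rewrite [X in is_derive _ _ X _](_ : tproj = fun y => (tproj y)^T).
  exact: is_derive_trmx (dtproj _ Vz).
by apply/funext => y; rewrite tproj_sym.
Qed.

Lemma sff_tproj z v : V z -> sff z v *m tproj z + tproj z *m sff z v = sff z v.
Proof.
move=> Vz; have D := dtproj (J *m (coframe z *m v)) Vz.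
have DD := is_derive_mulmx D D.
apply: is_derive_uniq D; apply: near_eq_is_derive DD.
by apply: (near_open oV Vz) => y Vy; rewrite tproj_idem.
Qed.

(** Multiplying K = K Pi + Pi K by Pi on both sides gives Pi K Pi = 2 Pi K Pi: K carries tangent
    vectors to normal ones. *)
Lemma tproj_sff_tproj z v : V z -> tproj z *m sff z v *m tproj z = 0.
Proof.
move=> Vz; have := sff_tproj v Vz; have := tproj_idem Vz.
move: (sff z v) (tproj z) => K T TT /(congr1 (fun A => T *m A *m T)).
rewrite mulmxDr mulmxDl !mulmxA TT -[T *m K *m T *m T]mulmxA TT => /eqP.
by rewrite -subr_eq0 addrK => /eqP.
Qed.

Lemma tangent_fix x v : U x -> M x -> tangent M x v <-> tproj (phi x) *m v = v.
Proof.
move=> Ux Mx; have [Vx px] := phiK Ux; rewrite tangentE//; split=> [[a _ <-]|E].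
  by rewrite mulmxA tproj_frame.
by exists (coframe (phi x) *m v) => //; rewrite mulmxA -tprojE.
Qed.

Lemma bundleE k x P : U x -> grassmann_bundle M k (x, P) <->
  [/\ M x, P^T = P, P *m P = P, \rank P = k & tproj (phi x) *m P = P].
Proof.
move=> Ux; split=> [[/= Mx Pt PP rP PS]|[Mx Pt PP rP PS]]; split=> //=.
  apply/matrixP => i j.
  have /tangent_fix/= := PS (delta_mx j 0); move=> /(_ Ux Mx) /colP/(_ i).
  by rewrite mulmxA -!colE !mxE.
by move=> u; apply/tangent_fix => //; rewrite mulmxA PS.
Qed.

(** Any frame satisfies P = sum of q q^T, so by symmetry of K the defining sums collapse to K P + P
    K; a frame exists by [orthonormal_frame], so the chosen one is genuine. *)
Lemma second_ff_hatE k x u P : U x -> grassmann_bundle M k (x, P) ->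
  tangent M x u ->
  second_ff_hat M k x u P = sff (phi x) u *m P + P *m sff (phi x) u.
Proof.
move=> Ux Gw Tu; have [Mx Pt PP rP PS] := (bundleE k P Ux).1 Gw.
have [Vx px] := phiK Ux.
have sE v : second_ff M x u v = sff (phi x) u *m v.
  congr (_ *m _); apply: mdiff_chart => //; last exact: differentiable_tproj.
  by move=> y Uy My; exact: proj_tangentE.
have [E EE EP] := orthonormal_frame Pt PP rP.
have fr : is_frame (tangent M x) P (fun l => col l E).
  split=> [l|l l'|].
  - by apply/tangent_fix => //; rewrite -(frame_col_fix l EE EP) mulmxA PS.
  - rewrite /dotv; have := congr1 (fun A : 'M[R]_k => A l l') EE.
    rewrite !mxE => <-; apply: eq_bigr => i _; by rewrite !mxE.
  - rewrite -EP; apply/matrixP => i j; rewrite summxE !mxE; apply: eq_bigr => l _.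
    by rewrite !mxE big_ord1 !mxE.
rewrite /second_ff_hat; set q := xget _ _.
have [_ _ PE] : is_frame (tangent M x) P q by apply: xgetPex; exists (fun l => col l E).
rewrite {1}PE mulmx_sumr PE mulmx_suml; congr (_ + _).
  by apply: eq_bigr => l _; rewrite sE mulmxA.
by apply: eq_bigr => l _; rewrite sE trmx_mul sff_sym// mulmxA.
Qed.

Lemma saddle_field1E x P : U x -> M x ->
  saddle_field1 M f (x, P) = - (grad (phi x) - 2 *: (P *m grad (phi x))).
Proof. by move=> Ux Mx; rewrite /saddle_field1 /reflection /= rgradE. Qed.

Lemma saddle_field1_tangent k x P : U x -> grassmann_bundle M k (x, P) ->
  tangent M x (saddle_field1 M f (x, P)).
Proof.
move=> Ux /(bundleE k P Ux)[Mx Pt PP rP PS]; have [Vx px] := phiK Ux.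
apply/tangent_fix => //; rewrite saddle_field1E// mulmxN mulmxBr -scalemxAr.
by rewrite [tproj _ *m (P *m _)]mulmxA PS tproj_grad.
Qed.

Definition field2_at z (P : 'M[R]_n) (h1 : 'cV[R]_n) : 'M[R]_n :=
  - commutator P (commutator P (hess z)) + (sff z h1 *m P + P *m sff z h1).

Lemma saddle_field2E k x P : U x -> grassmann_bundle M k (x, P) ->
  saddle_field2 M f k (x, P) = field2_at (phi x) P (saddle_field1 M f (x, P)).
Proof.
move=> Ux Gw; have [Mx Pt PP rP PS] := (bundleE k P Ux).1 Gw.
rewrite /saddle_field2 /= rhessE// (second_ff_hatE Ux Gw)//.
exact: saddle_field1_tangent Gw.
Qed.

(** From g = 2 P g one gets P g = 2 P g, so P g = 0 and g = 0. The curvature term is linear in h_1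
    and vanishes with it, leaving the double commutator. *)
Lemma saddle_field_eq0 k x P : U x -> grassmann_bundle M k (x, P) ->
  saddle_field M f k (x, P) = 0 <->
  grad (phi x) = 0 /\ P *m hess (phi x) = hess (phi x) *m P.
Proof.
move=> Ux Gw; have [Mx Pt PP rP PS] := (bundleE k P Ux).1 Gw.
rewrite /saddle_field (saddle_field2E Ux Gw) saddle_field1E//.
have -> : (0 : 'cV[R]_n * 'M[R]_n) = (0, 0) by [].
split=> [[h1 h2]|[g0 PH]].
  have g0 : grad (phi x) = 0.
    move: h1; move: (grad (phi x)) => g /eqP; rewrite oppr_eq0 subr_eq0 => /eqP g2.
    have Pg : P *m g = 0.
      have : P *m g = 2 *: (P *m g) by rewrite {1}g2 -scalemxAr mulmxA PP.
      by rewrite scaler_nat mulr2n => /eqP; rewrite -subr_eq0 opprD addNKr oppr_eq0 => /eqP.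
    by rewrite g2 Pg scaler0.
  split=> //; apply/(commutator_comm _ PP).
  move: h2; rewrite h1 /field2_at sff0 mul0mx mulmx0 !addr0 => /eqP.
  by rewrite oppr_eq0 => /eqP.
rewrite g0 mulmx0 scaler0 subr0 oppr0; congr (_, _).
by rewrite /field2_at sff0 mul0mx mulmx0 !addr0 (commutator_comm _ PP).2 ?oppr0.
Qed.

(* [lift] is the horizontal part of a tangent vector of the bundle, forced by the
   motion of the tangent spaces along u; [vertical] is the tangent space of the
   fibre, the Grassmannian of the tangent space at psi z. *)
Definition lift z (P : 'M[R]_n) u : 'M[R]_n := sff z u *m P + P *m sff z u.

Definition vertical z (P Om : 'M[R]_n) : Prop :=
  [/\ Om^T = Om, tproj z *m Om = Om & P *m Om + Om *m P = Om].

Lemma proj_sff_proj z P u : V z -> P^T = P -> tproj z *m P = P ->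
  tproj z *m (sff z u *m P) = 0 /\ P *m sff z u *m P = 0.
Proof.
move=> Vz Pt PS; have PT : P *m tproj z = P by rewrite -{1}Pt -tproj_sym -trmx_mul PS Pt.
have TKP : tproj z *m (sff z u *m P) = 0.
  have := tproj_sff_tproj u Vz; move: (tproj z) (sff z u) PS => T K PS TKT.
  by rewrite -{1}PS !mulmxA TKT mul0mx.
by split=> //; rewrite -mulmxA -{1}PT -[P *m _ *m _]mulmxA TKP mulmx0.
Qed.

Lemma bundle_curve k x P u D c : U x -> grassmann_bundle M k (x, P) ->
  curve_through (grassmann_bundle M k) (x, P) (u, D) c ->
  [/\ c 0 = (x, P), is_derive (0 : R) 1 (fun t => (c t).1) u,
      is_derive (0 : R) 1 (fun t => (c t).2) D,
      is_derive (0 : R) 1 (fun t => phi (c t).1) (J *m (coframe (phi x) *m u)) &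
      \forall t \near (0 : R), U (c t).1 /\ grassmann_bundle M k (c t)] /\
  tangent M x u.
Proof.
move=> Ux Gw /curve_throughP[c0 /is_derive_pairP[D1 D2] Gc].
have Mx := (bundleE k P Ux).1 Gw; case: Mx => Mx _ _ _ _; have [Vx px] := phiK Ux.
have c10 : (c 0).1 = x by rewrite c0.
have Mc : \forall t \near (0 : R), M (c t).1 by apply: filterS Gc => t [].
have [a ua Dz] := curve_in_chart Ux c10 D1 Mc.
have dc1 : differentiable (fun t => (c t).1) 0 by apply/derivable1_diffP; case: D1.
split; last by rewrite tangentE// ua; exists a.
split=> //; first by rewrite ua [coframe _ *m _]mulmxA coframeK// mul1mx.
apply: filterI => //; apply: (differentiable_continuous dc1); rewrite c10.
exact: open_nbhs_nbhs.
Qed.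

(** Differentiating P^T = P, P P = P and Pi P = P along the curve gives D^T = D, D P + P D = D and K
    P + Pi D = D; subtracting the lift leaves the equations of a vertical operator. *)
Lemma tangent_bundle_vertical k x P u D : U x -> grassmann_bundle M k (x, P) ->
  tangent (grassmann_bundle M k) (x, P) (u, D) ->
  tangent M x u /\ vertical (phi x) P (D - lift (phi x) P u).
Proof.
move=> Ux Gw [c cP]; have [[c0 D1 D2 Dz near0] Tu] := bundle_curve Ux Gw cP.
split=> //; have [Mx Pt PP rP PS] := (bundleE k P Ux).1 Gw; have [Vx px] := phiK Ux.
have dz : differentiable (fun t => phi (c t).1) 0 by apply/derivable1_diffP; case: Dz.
have DT : is_derive (0 : R) 1 (fun t => tproj (phi (c t).1)) (sff (phi x) u).
  have dT : differentiable tproj (phi (c 0).1) by rewrite c0; exact: differentiable_tproj.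
  by have := is_derive_comp dz Dz dT; rewrite c0.
have facts t : U (c t).1 -> grassmann_bundle M k (c t) ->
    [/\ (c t).2^T = (c t).2, (c t).2 *m (c t).2 = (c t).2
      & tproj (phi (c t).1) *m (c t).2 = (c t).2].
  by case: (c t) => y Q /= Uy /(bundleE k Q Uy)[].
have Dt : D^T = D.
  apply: (is_derive_uniq (is_derive_trmx D2)); apply: near_eq_is_derive D2.
  by apply: filterS near0 => t [/facts H] /H[].
have DPPD : D *m P + P *m D = D.
  have := is_derive_mulmx D2 D2; rewrite c0 => H.
  apply: (is_derive_uniq H); apply: near_eq_is_derive D2.
  by apply: filterS near0 => t [/facts H'] /H'[].
have KPTD : sff (phi x) u *m P + tproj (phi x) *m D = D.
  have := is_derive_mulmx DT D2; rewrite c0 => H.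
  apply: (is_derive_uniq H); apply: near_eq_is_derive D2.
  by apply: filterS near0 => t [/facts H'] /H'[].
have [TKP PKP] := proj_sff_proj u Vx Pt PS.
have Kt := sff_sym u Vx.
move: PS TKP PKP Kt KPTD; rewrite /vertical /lift.
move: (sff (phi x) u) (tproj (phi x)) => K T PS TKP PKP Kt KPTD; split.
- by rewrite linearB linearD/= !trmx_mul Dt Pt Kt [P *m K + _]addrC.
- rewrite mulmxBr mulmxDr TKP mulmxA PS add0r.
  by rewrite -[in RHS]KPTD opprD addrA [K *m P + _]addrC addrK.
- rewrite mulmxBr mulmxBl mulmxDr mulmxDl !mulmxA PP PKP.
  rewrite -[K *m P *m P]mulmxA PP addr0 add0r.
  by rewrite addrACA -opprD [P *m D + _]addrC DPPD [P *m K + _]addrC.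
Qed.

(* The curve of subspaces is the span of Pi(x(t)) (E + t Om E), where the columns
   of E are an orthonormal basis of Ran P. *)
Lemma tangent_bundle_lift k x P u Om : U x -> grassmann_bundle M k (x, P) ->
  tangent M x u -> vertical (phi x) P Om ->
  tangent (grassmann_bundle M k) (x, P) (u, lift (phi x) P u + Om).
Proof.
move=> Ux Gw Tu [Omt TOm POm]; have [Mx Pt PP rP PS] := (bundleE k P Ux).1 Gw.
have [Vx px] := phiK Ux; move: (Tu); rewrite tangentE// => -[a _ /esym ua].
set z := phi x in Vx px ua TOm PS *.
have [E EE EP] := orthonormal_frame Pt PP rP.
have PE : P *m E = E by rewrite -EP -mulmxA EE mulmx1.
have TE : tproj z *m E = E by rewrite -PE mulmxA PS.
have [e e0 [Ve Se]] := Ck_slice_line a Vx.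
pose zt (t : R) := z + t *: (J *m a).
pose Ft (t : R) := tproj (zt t) *m (E + t *: (Om *m E)).
have zt0 : zt 0 = z by rewrite /zt scale0r addr0.
have Ft0 : Ft 0 = E by rewrite /Ft zt0 scale0r addr0.
have SF r : Ck_on r (ball (0 : R) e) Ft.
  apply: Ck_mulmx; first exact: ball_open.
    exact: (Ck_comp (ball_open _ _) oV Ve (Se r) (Ck_tproj r)).
  apply: Ck_add; [exact: ball_open|exact: Ck_cst|].
  by apply: (@Ck_linear _ _ _ _ _ (@scalel R _ (Om *m E))); exact: scalel_continuous.
have be : ball (0 : R) e 0 by exact: ballxx.
have near_unit : \forall t \near (0 : R), (Ft t)^T *m Ft t \in unitmx.
  have Cd : Ck_on 0 (ball (0 : R) e) (fun t => \det ((Ft t)^T *m Ft t)).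
    apply: Ck_det; first exact: ball_open.
    apply: Ck_mulmx; [exact: ball_open| |exact: SF].
    by apply: Ck_trmx; [exact: ball_open|exact: SF].
  have : \det ((Ft t)^T *m Ft t) @[t --> (0 : R)] --> \det ((Ft 0)^T *m Ft 0) := Cd 0 be.
  rewrite Ft0 EE det1 => /cvgr_neq0 H.
  have := H (oner_neq0 _); apply: filterS => t; by rewrite unitmxE unitfE.
have [e1 e10 He1] := (nbhs_ballP _ _).1 near_unit.
pose e2 := Num.min e e1.
have e20 : 0 < e2 by rewrite lt_min e0.
have sub1 : ball (0 : R) e2 `<=` ball (0 : R) e by apply: le_ball; rewrite ge_min lexx.
have sub2 : ball (0 : R) e2 `<=` ball (0 : R) e1 by apply: le_ball; rewrite ge_min lexx orbT.
have dF : is_derive (0 : R) 1 Ft (sff z u *m E + Om *m E).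
  have dzt : is_derive (0 : R) 1 zt (J *m a) by exact: is_derive_line.
  have dzt' : differentiable zt 0 by exact: differentiable_line.
  have dT : differentiable tproj (zt 0) by rewrite zt0; exact: differentiable_tproj.
  have D1 := is_derive_comp dzt' dzt dT.
  apply: is_derive_eq (is_derive_mulmx D1 (is_derive_line E (Om *m E) 0)) _.
  have -> : 'd tproj (zt 0) (J *m a) = sff z u.
    by rewrite zt0 /sff ua [coframe z *m _]mulmxA coframeK// mul1mx.
  have -> : E + 0 *: (Om *m E) = E by rewrite scale0r addr0.
  by rewrite zt0 [tproj z *m (Om *m E)]mulmxA TOm.
pose Pt' (t : R) := colproj (Ft t).
have SP r : Ck_on r (ball (0 : R) e2) Pt'.
  apply: Ck_colproj; first exact: ball_open.
    by move=> t /sub2; exact: He1.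
  exact: Ck_sub sub1 (SF r).
have Pt0 : Pt' 0 = P.
  by rewrite /Pt' Ft0 /colproj EE invmx1 mulmx1 EP.
have dP' : differentiable Pt' 0.
  by apply: (Ck_differentiable (SP 1%N)); exact: ballxx.
have dP := derivableP (diff_derivable dP' : derivable Pt' (0 : R) (1 : R)).
move: ('D_1 Pt' 0) dP => D dP.
(* Differentiating the relation that the projector fixes [Ft t] avoids differentiating the inverse
   Gram matrix. *)
have DE : D *m E + P *m (sff z u *m E + Om *m E) = sff z u *m E + Om *m E.
  have := is_derive_mulmx dP dF; rewrite Pt0 Ft0 => H.
  apply: (is_derive_uniq H); apply: near_eq_is_derive dF.
  by apply: filterS near_unit => t tu; rewrite colprojK.
have Dt : D^T = D.
  apply: (is_derive_uniq (is_derive_trmx dP)); apply: near_eq_is_derive dP.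
  by apply: filterS near_unit => t _; rewrite /Pt' colproj_sym.
have DD : D *m P + P *m D = D.
  have := is_derive_mulmx dP dP; rewrite Pt0 => H.
  apply: (is_derive_uniq H); apply: near_eq_is_derive dP.
  by apply: filterS near_unit => t tu; rewrite colproj_idem.
have [TKP PKP] := proj_sff_proj u Vx Pt PS.
have POmP := idem_sandwich0 PP POm.
have DP : D *m P = sff z u *m P + Om *m P.
  have KE : (sff z u *m E + Om *m E) *m E^T = sff z u *m P + Om *m P.
    by rewrite mulmxDl -!mulmxA EP.
  rewrite -[RHS]KE -DE mulmxDl -[D *m E *m _]mulmxA EP -mulmxA KE.
  by rewrite mulmxDr !mulmxA PKP POmP !addr0.
(* D = D P + P D with P D the transpose of D P, so D P determines D. *)
have DL : D = lift z P u + Om.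
  have PD : P *m D = P *m sff z u + P *m Om.
    by rewrite -{1}Pt -Dt -trmx_mul DP linearD/= !trmx_mul Pt Omt sff_sym.
  by rewrite -DD DP PD addrACA [Om *m P + _]addrC POm.
exists (fun t => (psi (zt t), Pt' t)); split.
- exists e2 => //; split=> [t te|r]; last first.
    apply: Ck_pair; [exact: ball_open| |exact: SP].
    apply: Ck_sub sub1 _.
    exact: (Ck_comp (ball_open _ _) oV Ve (Se r) (Spsi r)).
  have Vt : V (zt t) by exact/Ve/sub1.
  have [Ut pt] := psiK Vt; have ut := He1 _ (sub2 _ te).
  apply/(bundleE k (Pt' t) Ut); split.
  + apply: chart_M => // i di.
    by rewrite mxE [X in _ + X]mxE slice_incl_tail// mulr0 addr0 phi_tail.
  + exact: colproj_sym.
  + exact: colproj_idem.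
  + apply/eqP; rewrite eqn_leq; apply/andP; split.
      by rewrite /Pt' /colproj -mulmxA; apply: leq_trans (mxrankM_maxl _ _) (rank_leq_col _).
    have E1 : 1%:M = invmx ((Ft t)^T *m Ft t) *m ((Ft t)^T *m (Pt' t *m Ft t)).
      by rewrite colprojK// mulVmx.
    rewrite -{1}(mxrank1 R k) E1; do 2![apply: leq_trans (mxrankM_maxr _ _) _].
    exact: mxrankM_maxl.
  + rewrite pt; apply: mulmx_colproj.
    by rewrite /Ft [tproj _ *m (_ *m _)]mulmxA tproj_idem.
- by rewrite zt0 px Pt0.
- apply: derive1_val; apply/is_derive_pairP; split=> /=; last by rewrite -DL.
  have dzt : is_derive (0 : R) 1 zt (J *m a) by exact: is_derive_line.
  have dzt' : differentiable zt 0 by exact: differentiable_line.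
  have dpsi0 : differentiable psi (zt 0) by rewrite zt0; exact: dpsi.
  have := is_derive_comp dzt' dzt dpsi0.
  by rewrite zt0 -frameE// ua.
Qed.

(** * The differential of the saddle field at a zero *)

(** The term with second derivatives of the projector is multiplied by w(0) = 0, so only the
    variation of w contributes. *)
Lemma is_derive_sff (zt w : R -> 'cV[R]_n) z q dw : V z -> zt 0 = z ->
  is_derive (0 : R) 1 zt q -> w 0 = 0 -> is_derive (0 : R) 1 w dw ->
  is_derive (0 : R) 1 (fun t => sff (zt t) (w t)) (sff z dw).
Proof.
move=> Vz zt0 Dz w0 Dw.
have dz : differentiable zt 0 by apply/derivable1_diffP; case: Dz.
have nearV : \forall t \near (0 : R), V (zt t).
  by apply: (differentiable_continuous dz); rewrite zt0; exact: open_nbhs_nbhs.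
have sffE y v : V y -> sff y v =
    \sum_i (coframe y *m v) i 0 *: 'D_(slice_dir dn i) tproj y.
  move=> Vy; rewrite /sff slice_inclE linear_sum; apply: eq_bigr => i _.
  by rewrite linearZ deriveE//; exact: differentiable_tproj.
have dL : differentiable coframe (zt 0).
  by rewrite zt0; exact: Ck_differentiable (Ck_coframe 1) Vz.
have Da := is_derive_mulmx (is_derive_comp dz Dz dL) Dw.
have Di i : is_derive (0 : R) 1
    (fun t => (coframe (zt t) *m w t) i 0 *: 'D_(slice_dir dn i) tproj (zt t))
    ((coframe z *m dw) i 0 *: 'D_(slice_dir dn i) tproj z).
  have CT : Ck_on 1 V (fun y => 'D_(slice_dir dn i) tproj y).
    by have [_] := Ck_tproj 2; apply.
  have dT : differentiable (fun y => 'D_(slice_dir dn i) tproj y) (zt 0).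
    by rewrite zt0; exact: Ck_differentiable CT Vz.
  have Dai := (is_derive_mxP _ _ _ _).1 Da i 0.
  apply: is_derive_eq (is_derive_scale Dai (is_derive_comp dz Dz dT)) _.
  rewrite w0 zt0; move: ('d coframe z q) ('d _ z q) ('D__ tproj z) (coframe z) => L' T' T0 L.
  by rewrite !mulmx0 add0r [(0 : 'cV[R]_d) i 0]mxE scale0r addr0.
rewrite sffE//.
have := is_derive_sum Di; apply: near_eq_is_derive.
by apply: filterS nearV => t Vt; rewrite sffE// fct_sumE.
Qed.

(** Differentiating Pi grad = grad where grad = 0 shows that the derivative of the gradient is
    already tangent, so the projection in the Hessian does not change it. *)
Lemma dgrad_critical z u : V z -> grad z = 0 -> tproj z *m u = u ->
  'd grad z (J *m (coframe z *m u)) = hess z *m u.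
Proof.
move=> Vz g0 Tu.
have dg : differentiable grad z := Ck_differentiable Ck_grad Vz.
have Dg : is_derive z (J *m (coframe z *m u)) grad ('d grad z (J *m (coframe z *m u))).
  by rewrite -deriveE//; exact/derivableP/diff_derivable.
have := is_derive_mulmx (dtproj (J *m (coframe z *m u)) Vz) Dg.
rewrite g0 mulmx0 add0r => D.
have E : tproj z *m 'd grad z (J *m (coframe z *m u)) = 'd grad z (J *m (coframe z *m u)).
  apply: (is_derive_uniq D); apply: near_eq_is_derive Dg.
  by apply: (near_open oV Vz) => y Vy; rewrite tproj_grad.
rewrite -E -slice_jacobianE// /hess -/(dgrad z).
move: (tproj z) (dgrad z) (coframe z) => T G L.
by rewrite !mulmxA.
Qed.

Definition dhess z u : 'M[R]_n := 'd hess z (J *m (coframe z *m u)).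

Lemma dhess_is_derive z u : V z -> is_derive z (J *m (coframe z *m u)) hess (dhess z u).
Proof.
move=> Vz; have D : differentiable hess z := Ck_differentiable Ck_hess Vz.
by rewrite /dhess -deriveE//; exact/derivableP/diff_derivable.
Qed.

Lemma dhess_sym z u : V z -> (dhess z u)^T = dhess z u.
Proof.
move=> Vz; have D := dhess_is_derive u Vz.
apply: (is_derive_uniq (is_derive_trmx D)); apply: near_eq_is_derive D.
by apply: (near_open oV Vz) => y Vy; rewrite hess_sym.
Qed.

Lemma hess_tproj z : V z -> hess z *m tproj z = hess z.
Proof.
by move=> Vz; rewrite -{1}(hess_sym Vz) -(tproj_sym z) -trmx_mul tproj_hess// hess_sym.
Qed.

(** Product rule for H = Pi H Pi; the outer terms come from the turning of the tangent spaces. *)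
Lemma dhessE z u : V z ->
  dhess z u = sff z u *m hess z + tproj z *m dhess z u *m tproj z + hess z *m sff z u.
Proof.
move=> Vz; have D := dhess_is_derive u Vz.
have DT := dtproj (J *m (coframe z *m u)) Vz.
have E (T H K X : 'M[R]_n) : T *m H = H -> H *m T = H ->
    (K *m H + T *m X) *m T + T *m H *m K = K *m H + T *m X *m T + H *m K.
  by move=> TH HT; rewrite mulmxDl -[K *m H *m T]mulmxA HT TH.
have := is_derive_mulmx (is_derive_mulmx DT D) DT.
rewrite (E _ _ _ _ (tproj_hess Vz) (hess_tproj Vz)) => DD.
apply: (is_derive_uniq D); apply: near_eq_is_derive DD.
by apply: (near_open oV Vz) => y Vy; rewrite tproj_hess// hess_tproj.
Qed.

Definition dfield1 z (P : 'M[R]_n) u : 'cV[R]_n :=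
  - (hess z *m u - 2 *: (P *m (hess z *m u))).

(** At a zero of the field grad f and [P, H] vanish, so the variation of P in the reflection and in
    the outer commutator drops out. *)
Lemma field_is_derive k x P u D c : U x -> grassmann_bundle M k (x, P) ->
  grad (phi x) = 0 -> P *m hess (phi x) = hess (phi x) *m P ->
  curve_through (grassmann_bundle M k) (x, P) (u, D) c ->
  is_derive (0 : R) 1 (fun t => saddle_field M f k (c t))
    (dfield1 (phi x) P u,
     - commutator P (commutator D (hess (phi x)) + commutator P (dhess (phi x) u)) +
     lift (phi x) P (dfield1 (phi x) P u)).
Proof.
move=> Ux Gw g0 PH cP; have [Vx px] := phiK Ux.
have [[c0 D1 D2 Dz near0] Tu] := bundle_curve Ux Gw cP.
have [Mx Pt PP rP PS] := (bundleE k P Ux).1 Gw.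
have Tu' := (tangent_fix u Ux Mx).1 Tu.
pose zt (t : R) := phi (c t).1; pose Pt' (t : R) := (c t).2.
have zt0 : zt 0 = phi x by rewrite /zt c0.
have Pt0 : Pt' 0 = P by rewrite /Pt' c0.
have dz : differentiable zt 0 by apply/derivable1_diffP; case: Dz.
have dg : differentiable grad (zt 0) by rewrite zt0; exact: Ck_differentiable Ck_grad Vx.
have dH : differentiable hess (zt 0) by rewrite zt0; exact: Ck_differentiable Ck_hess Vx.
have Dg : is_derive (0 : R) 1 (fun t => grad (zt t)) (hess (phi x) *m u).
  apply: is_derive_eq (is_derive_comp dz Dz dg) _.
  by rewrite zt0; exact: dgrad_critical.
have DH : is_derive (0 : R) 1 (fun t => hess (zt t)) (dhess (phi x) u).
  by apply: is_derive_eq (is_derive_comp dz Dz dH) _; rewrite zt0.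
pose h1 (t : R) := - (grad (zt t) - 2 *: (Pt' t *m grad (zt t))).
have Dh1 : is_derive (0 : R) 1 h1 (dfield1 (phi x) P u).
  have DPg := is_derive_mulmx D2 Dg.
  apply: is_derive_eq (is_deriveN (is_deriveB Dg (is_deriveZ 2 DPg))) _.
  by rewrite zt0 g0 mulmx0 add0r c0.
have h10 : h1 0 = 0 by rewrite /h1 zt0 g0 mulmx0 scaler0 subr0 oppr0.
have DS := is_derive_sff Vx zt0 Dz h10 Dh1.
have Dh2 : is_derive (0 : R) 1 (fun t => field2_at (zt t) (Pt' t) (h1 t))
    (- commutator P (commutator D (hess (phi x)) + commutator P (dhess (phi x) u)) +
     lift (phi x) P (dfield1 (phi x) P u)).
  have DC := is_derive_commutator D2 (is_derive_commutator D2 DH).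
  have DL := is_deriveD (is_derive_mulmx DS D2) (is_derive_mulmx D2 DS).
  apply: is_derive_eq (is_deriveD (is_deriveN DC) DL) _.
  rewrite zt0 h10 sff0 mulmx0 mul0mx addr0 add0r c0/=.
  have -> : commutator P (hess (phi x)) = 0 by rewrite /commutator PH subrr.
  by rewrite {1}/commutator mulmx0 mul0mx subrr add0r.
apply/is_derive_pairP; split.
  apply: near_eq_is_derive Dh1.
  apply: filterS near0 => t [Ut Gt]; rewrite /h1 /zt /Pt'.
  by case: (c t) Ut Gt => y Q /= Uy [/= My _ _ _ _]; rewrite saddle_field1E.
apply: near_eq_is_derive Dh2.
apply: filterS near0 => t [Ut Gt]; rewrite /h1 /zt /Pt'.
case: (c t) Ut Gt => y Q /= Uy Gy; have [My _ _ _ _] := (bundleE k Q Uy).1 Gy.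
by rewrite (saddle_field2E Uy Gy) saddle_field1E.
Qed.

(** The off-diagonal block u |-> Om of the differential, caused by the tangential part of the
    variation of H. *)
Definition vertical_drift z (P : 'M[R]_n) u : 'M[R]_n :=
  - commutator P (commutator P (tproj z *m dhess z u *m tproj z)).

(** The value has again the form (u', lift u' + Om') with u' depending on u alone: this is the block
    triangular shape. *)
Lemma mdiff_field k x P u Om : U x -> grassmann_bundle M k (x, P) ->
  grad (phi x) = 0 -> P *m hess (phi x) = hess (phi x) *m P ->
  tangent (grassmann_bundle M k) (x, P) (u, lift (phi x) P u + Om) ->
  mdiff (grassmann_bundle M k) (saddle_field M f k) (x, P) (u, lift (phi x) P u + Om) =
  (dfield1 (phi x) P u,
   lift (phi x) P (dfield1 (phi x) P u) +
   (vertical_drift (phi x) P u - commutator P (commutator Om (hess (phi x))))).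
Proof.
move=> Ux Gw g0 PH Tw; have [Vx px] := phiK Ux.
have [Mx Pt PP rP PS] := (bundleE k P Ux).1 Gw.
have PT : P *m tproj (phi x) = P by rewrite -{1}Pt -tproj_sym -trmx_mul PS Pt.
apply: mdiff_curve => // c cP.
apply: is_derive_eq (field_is_derive Ux Gw g0 PH cP) _; congr (_, _).
rewrite addrC; congr (_ + _); rewrite /vertical_drift -opprD; congr (- _).
rewrite -commutatorDr; congr (commutator _ _).
rewrite commutatorDl addrAC {1}/lift {1}(dhessE u Vx); congr (_ + _).
exact: (lift_drift _ (tproj_sff_tproj u Vx) PS PT (tproj_hess Vx) (hess_tproj Vx) PH).
Qed.

(* For an eigenvector v of H, the functional (u, D) |-> <v, u> is a left
   eigenvector of the differential of the field. *)
Lemma steady_necessary k x P : U x -> grassmann_bundle M k (x, P) ->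
  linearly_steady (grassmann_bundle M k) (saddle_field M f k) (x, P) ->
  [/\ grad (phi x) = 0, P *m hess (phi x) = hess (phi x) *m P,
      forall (v : 'cV[R]_n) a, P *m v = v -> hess (phi x) *m v = a *: v -> v != 0 -> a < 0 &
      forall (v : 'cV[R]_n) a, (tproj (phi x) - P) *m v = v ->
        hess (phi x) *m v = a *: v -> v != 0 -> 0 < a].
Proof.
move=> Ux Gw [/(saddle_field_eq0 Ux Gw)[g0 PH] [m [b [A [LA neg]]]]].
have [Vx px] := phiK Ux; have [Mx Pt PP rP PS] := (bundleE k P Ux).1 Gw.
have Tsym := tproj_sym (phi x); have TT := tproj_idem Vx.
have Hsym := hess_sym Vx.
have key (v : 'cV[R]_n) a : tproj (phi x) *m v = v -> v != 0 ->
    (forall u, (v^T *m dfield1 (phi x) P u) 0 0 = a * (v^T *m u) 0 0) -> a < 0.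
  move=> Tv v0 va; have eA : eigenvalue A a.
    apply: (functional_eigenvalue (l := fun w => (v^T *m w.1) 0 0) LA).
    - move=> c; rewrite (raddf_sum (fst : {additive _ -> _})) mulmx_sumr summxE.
      by apply: eq_bigr => i _; rewrite /= -scalemxAr mxE.
    - move=> i; have [bT _] := LA; move: (basis_in i bT).
      case: (b i) => u D Tw; have [Tu _] := tangent_bundle_vertical Ux Gw Tw.
      have DE : D = lift (phi x) P u + (D - lift (phi x) P u) by rewrite addrC subrK.
      by rewrite DE in Tw *; rewrite (mdiff_field Ux Gw g0 PH Tw) /= va.
    (* The functional takes the nonzero value |v|^2 on the lift of v with zero vertical part. *)
    - exists (v, lift (phi x) P v + 0).
        apply: tangent_bundle_lift => //; first exact/tangent_fix.
        by split; rewrite ?trmx0 ?mulmx0 ?mul0mx ?addr0.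
      apply: contra v0 => /eqP vv; apply/eqP/tr_mulmx_eq0.
      by apply/matrixP => i j; rewrite !ord1 vv mxE.
  have /neg : eigenvalue (map_mx (real_complex R) A) (real_complex R a).
    by rewrite eigenvalue_map.
  by [].
split=> // v a Pv Hv v0.
- apply: (key v) => //; first by rewrite -Pv mulmxA PS.
  move=> u; rewrite /dfield1.
  have vP : v^T *m P = v^T by rewrite -{1}Pt -trmx_mul Pv.
  have vH : v^T *m hess (phi x) = a *: v^T by rewrite -{1}Hsym -trmx_mul Hv linearZ.
  have vHu : v^T *m (hess (phi x) *m u) = a *: (v^T *m u) by rewrite mulmxA vH -scalemxAl.
  rewrite mulmxN mulmxBr -scalemxAr [v^T *m (P *m _)]mulmxA vP vHu.
  by move: (v^T *m u) => s; rewrite !mxE; ring.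
- rewrite -oppr_lt0; apply: (key v) => //.
    by rewrite -{1}Pv mulmxA mulmxBr TT PS.
  move=> u; rewrite /dfield1.
  have vP : v^T *m P = 0.
    have PT : P *m tproj (phi x) = P by rewrite -{1}Pt -Tsym -trmx_mul PS Pt.
    by rewrite -{1}Pt -trmx_mul -Pv mulmxA mulmxBr PT PP subrr mul0mx trmx0.
  have vH : v^T *m hess (phi x) = a *: v^T by rewrite -{1}Hsym -trmx_mul Hv linearZ.
  have vHu : v^T *m (hess (phi x) *m u) = a *: (v^T *m u) by rewrite mulmxA vH -scalemxAl.
  rewrite mulmxN mulmxBr -scalemxAr [v^T *m (P *m _)]mulmxA vP mul0mx vHu.
  by move: (v^T *m u) => s; rewrite !mxE; ring.
Qed.

Lemma sff_linear z : linear (sff z).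
Proof.
by move=> a u v; rewrite /sff !mulmxDr -!scalemxAr linearP.
Qed.

Lemma lift_linear z P : linear (lift z P).
Proof.
move=> a u v; rewrite /lift sff_linear mulmxDl mulmxDr -scalemxAl -scalemxAr.
by rewrite scalerDr addrACA.
Qed.

Lemma vertical_drift_vertical z P u : V z -> P^T = P -> P *m P = P ->
  tproj z *m P = P -> vertical z P (vertical_drift z P u).
Proof.
move=> Vz Pt PP PS; rewrite /vertical_drift double_commutator//.
have TX : tproj z *m (tproj z *m dhess z u *m tproj z) = tproj z *m dhess z u *m tproj z.
  move: (tproj z) (tproj_idem Vz) (dhess z u) => T TT X.
  by rewrite !mulmxA TT.
have Xt : (tproj z *m dhess z u *m tproj z)^T = tproj z *m dhess z u *m tproj z.
  move: (tproj z) (tproj_sym z) (dhess z u) (dhess_sym u Vz) => T Tt X XX.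
  by rewrite !trmx_mul Tt XX mulmxA.
move: (tproj z *m dhess z u *m tproj z) TX Xt => X TX Xt; rewrite /vertical.
move: (tproj z) TX PS => T TX TP; split.
- rewrite [LHS]raddfN/=; congr (- _); rewrite !raddfB/= !trmx_mul Pt Xt !mulmxA.
  by rewrite !opprK addrC [- _ + P *m X]addrC [X *m P - _]addrC.
- by rewrite mulmxN !mulmxBr !mulmxA TP TX.
- rewrite mulmxN mulNmx -opprD; congr (- _).
  rewrite !mulmxBr !mulmxBl !mulmxA PP -[P *m X *m P *m P]mulmxA PP -[X *m P *m P]mulmxA PP.
  by rewrite !subrr subr0 sub0r.
Qed.

Lemma vertical_drift0 z Q : vertical_drift z Q 0 = 0.
Proof.
rewrite /vertical_drift /dhess !mulmx0 linear0 mulmx0 mul0mx.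
by rewrite /commutator !(mulmx0, mul0mx, subr0, oppr0).
Qed.

(** * Matrix of the differential and sufficiency of the sign conditions *)

Section MixedBlocks.
Context (k r : nat) (x : 'cV[R]_n) (P : 'M[R]_n) (E : 'M[R]_(n, k)) (F : 'M[R]_(n, r))
  (mu : 'rV[R]_k) (nu : 'rV[R]_r).
Hypotheses (Ux : U x) (Gw : grassmann_bundle M k (x, P))
  (g0 : grad (phi x) = 0) (PH : P *m hess (phi x) = hess (phi x) *m P)
  (EE : E^T *m E = 1%:M) (EP : E *m E^T = P)
  (HE : hess (phi x) *m E = E *m diag_mx mu)
  (FF : F^T *m F = 1%:M) (FQ : F *m F^T = tproj (phi x) - P)
  (HF : hess (phi x) *m F = F *m diag_mx nu).

Let Vx : V (phi x). Proof. by have [] := phiK Ux. Qed.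

(* [mixed] parametrizes the vertical directions by k x r matrices, and
   [field_mx] below is the matrix of the differential in the resulting basis. *)
Definition mixed (Y : 'M[R]_(k, r)) : 'M[R]_n := E *m Y *m F^T + F *m Y^T *m E^T.

Lemma mixed_linear : linear mixed.
Proof.
move=> a Y Z; rewrite /mixed [(_ + _)^T]linearP/= !mulmxDr !mulmxDl -!scalemxAr -!scalemxAl.
by rewrite scalerDr addrACA.
Qed.

Let Pt : P^T = P. Proof. by have [_] := (bundleE k P Ux).1 Gw. Qed.
Let PP : P *m P = P. Proof. by have [_ _] := (bundleE k P Ux).1 Gw. Qed.
Let TP : tproj (phi x) *m P = P. Proof. by have [_ _ _ _] := (bundleE k P Ux).1 Gw. Qed.
Let PT : P *m tproj (phi x) = P.
Proof. by rewrite -{1}Pt -tproj_sym -trmx_mul TP Pt. Qed.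
Let PE : P *m E = E. Proof. by rewrite -EP -mulmxA EE mulmx1. Qed.
Let EtP : E^T *m P = E^T. Proof. by rewrite -{1}Pt -trmx_mul PE. Qed.
Let PF : P *m F = 0.
Proof.
rewrite -[F]mulmx1 -FF [F *m _]mulmxA FQ mulmxA mulmxBr PT PP subrr.
by rewrite mul0mx.
Qed.
Let FtP : F^T *m P = 0. Proof. by rewrite -{1}Pt -trmx_mul PF trmx0. Qed.
Let TE : tproj (phi x) *m E = E. Proof. by rewrite -PE mulmxA TP. Qed.
Let TF : tproj (phi x) *m F = F.
Proof.
have TQ : tproj (phi x) *m (tproj (phi x) - P) = tproj (phi x) - P.
  by rewrite mulmxBr tproj_idem// TP.
by rewrite -[F]mulmx1 -FF [F *m _]mulmxA FQ mulmxA TQ.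
Qed.
Let EtF : E^T *m F = 0.
Proof. by rewrite -EtP -mulmxA PF mulmx0. Qed.
Let FtE : F^T *m E = 0.
Proof. by rewrite -[LHS]trmxK trmx_mul trmxK EtF trmx0. Qed.

Lemma mixed_vertical Y : vertical (phi x) P (mixed Y).
Proof.
rewrite /mixed; split.
- by rewrite linearD/= !trmx_mul !trmxK !mulmxA addrC.
- move: (tproj (phi x)) TE TF => T TE' TF'.
  by rewrite mulmxDr !mulmxA TE' TF'.
- rewrite mulmxDr mulmxDl !mulmxA PE PF !mul0mx addr0.
  by rewrite -[E *m Y *m _ *m P]mulmxA FtP mulmx0 add0r -[F *m _ *m _ *m P]mulmxA EtP.
Qed.

(** P Om P = 0 and Om Pi = Om give P Om = P Om (Pi - P) = E Y F^T, and Om is this plus its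
    transpose. *)
Lemma vertical_mixed Om : vertical (phi x) P Om -> Om = mixed (E^T *m Om *m F).
Proof.
move=> [Omt TOm POm].
have POmP := idem_sandwich0 PP POm.
have OmT : Om *m tproj (phi x) = Om by rewrite -{1}Omt -tproj_sym -trmx_mul TOm Omt.
have PO : P *m Om = E *m (E^T *m Om *m F) *m F^T.
  rewrite !mulmxA EP -mulmxA FQ; move: (tproj (phi x)) OmT => T OmT.
  by rewrite mulmxBr POmP subr0 -mulmxA OmT.
have OP : Om *m P = F *m (E^T *m Om *m F)^T *m E^T.
  by rewrite -{1}Omt -{1}Pt -trmx_mul PO !trmx_mul !trmxK !mulmxA.
by rewrite /mixed -PO -OP POm.
Qed.

Lemma mixedK Y : E^T *m mixed Y *m F = Y.
Proof.
rewrite /mixed mulmxDr !mulmxA EE EtF mul1mx !mul0mx addr0.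
by rewrite -mulmxA FF mulmx1.
Qed.

(** [Om, H] is antisymmetric, and the commutator with P flips the sign of one of its two blocks,
    which restores the symmetric form. *)
Lemma commutator_mixed Y :
  - commutator P (commutator (mixed Y) (hess (phi x))) =
  mixed (diag_mx mu *m Y - Y *m diag_mx nu).
Proof.
have EtH : E^T *m hess (phi x) = diag_mx mu *m E^T.
  by rewrite -{1}(hess_sym Vx) -trmx_mul HE trmx_mul tr_diag_mx.
have FtH : F^T *m hess (phi x) = diag_mx nu *m F^T.
  by rewrite -{1}(hess_sym Vx) -trmx_mul HF trmx_mul tr_diag_mx.
move: (hess (phi x)) EtH FtH HE HF => H EtH FtH HE' HF'.
have C1 : commutator (mixed Y) H =
    E *m (Y *m diag_mx nu - diag_mx mu *m Y) *m F^T +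
    F *m (Y^T *m diag_mx mu - diag_mx nu *m Y^T) *m E^T.
  rewrite /commutator /mixed mulmxDl mulmxDr !mulmxA HE' HF'.
  rewrite -[E *m Y *m F^T *m H]mulmxA FtH -[F *m Y^T *m E^T *m H]mulmxA EtH.
  rewrite !mulmxBr !mulmxBl !mulmxA opprD addrACA.
  by [].
rewrite C1 /commutator mulmxDr mulmxDl !mulmxA PE PF !mul0mx addr0.
rewrite -[_ *m F^T *m P]mulmxA FtP mulmx0 add0r -[_ *m E^T *m P]mulmxA EtP opprB.
rewrite /mixed [(_ - _)^T]linearB/= !trmx_mul !tr_diag_mx addrC; congr (_ + _).
by rewrite -mulNmx -mulmxN opprB.
Qed.

Lemma dfield1_frame (w : 'cV[R]_(k + r)) :
  dfield1 (phi x) P (row_mx E F *m w) =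
  row_mx E F *m (diag_mx (row_mx mu (- nu)) *m w).
Proof.
rewrite /dfield1; move: (hess (phi x)) HE HF => H HE' HF'.
rewrite !mulmxA scalemxAl -mulmxBl -mulNmx; congr (_ *m w).
have PHE : P *m H *m E = E *m diag_mx mu by rewrite -mulmxA HE' mulmxA PE.
have PHF : P *m H *m F = 0 by rewrite -mulmxA HF' mulmxA PF mul0mx.
rewrite !mul_mx_row HE' HF' PHE PHF.
rewrite diag_mx_row mul_row_block !mulmx0 addr0 add0r.
rewrite scale_row_mx scaler0 opp_row_mx add_row_mx subr0 opp_row_mx linearN/= mulmxN.
by rewrite opprB scaler_nat mulr2n addrK.
Qed.

(** The first k + r coordinates are those of u in the frame (E, F), the last k r those of Y, in
    accordance with the dimension d + k (d - k). Each u comes with its lift, so that the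
    differential is triangular. *)
Definition bundle_param (c : 'rV[R]_((k + r) + k * r)) : 'cV[R]_n * 'M[R]_n :=
  (row_mx E F *m (lsubmx c)^T,
   lift (phi x) P (row_mx E F *m (lsubmx c)^T) + mixed (vec_mx (rsubmx c))).

Lemma bundle_param_linear : linear bundle_param.
Proof.
move=> a c c'; rewrite /bundle_param !linearP/=.
rewrite lift_linear mixed_linear.
apply: injective_projections; first by [].
by rewrite /= [a *: (_ + mixed _)]scalerDr addrACA.
Qed.

Lemma bundle_param_sum (c : 'rV[R]_((k + r) + k * r)) :
  \sum_i c 0 i *: bundle_param (delta_mx 0 i) = bundle_param c.
Proof.
pose glM := GRing.isLinear.Build _ _ _ _ _ bundle_param_linear.
pose gL : {linear _ -> _} := HB.pack bundle_param glM.
rewrite [in RHS](row_sum_delta c) -[RHS]/(gL _) linear_sum.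
by apply: eq_bigr => i _; rewrite linearZ.
Qed.

Lemma bundle_param_tangent c : tangent (grassmann_bundle M k) (x, P) (bundle_param c).
Proof.
have [Mx _ _ _ _] := (bundleE k P Ux).1 Gw.
apply: tangent_bundle_lift => //; last exact: mixed_vertical.
apply/tangent_fix => //; move: (tproj (phi x)) TE TF => T TE' TF'.
by rewrite mulmxA mul_mx_row TE' TF'.
Qed.

Let EFEF : (row_mx E F)^T *m row_mx E F = 1%:M.
Proof. by rewrite tr_row_mx mul_col_row EE FF EtF FtE -scalar_mx_block. Qed.

Let EFT : row_mx E F *m (row_mx E F)^T = tproj (phi x).
Proof. by rewrite tr_row_mx mul_row_col EP FQ addrC subrK. Qed.

Lemma bundle_param_basis :
  is_basis (tangent (grassmann_bundle M k) (x, P))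
    (fun i => bundle_param (delta_mx 0 i)).
Proof.
have [Mx _ _ _ _] := (bundleE k P Ux).1 Gw.
split=> [[u D]|c]; last first.
  rewrite bundle_param_sum => c0.
  have c1 : lsubmx c = 0.
    have u0 : row_mx E F *m (lsubmx c)^T = 0 by case: c0.
    apply: trmx_inj; rewrite trmx0 -[LHS]mul1mx -EFEF -[_ *m _ *m (lsubmx c)^T]mulmxA u0.
    by rewrite mulmx0.
  have c2 : rsubmx c = 0.
    have : lift (phi x) P (row_mx E F *m (lsubmx c)^T) + mixed (vec_mx (rsubmx c)) = 0.
      by case: c0.
    rewrite c1 trmx0 mulmx0 {1}/lift sff0 mul0mx mulmx0 !add0r => m0.
    apply: (can_inj vec_mxK); rewrite linear0 -[LHS]mixedK m0.
    by rewrite mulmx0 mul0mx.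
  by rewrite -[c]hsubmxK c1 c2 row_mx0.
split=> [Tw|[c ->]]; last by rewrite bundle_param_sum; exact: bundle_param_tangent.
have [Tu Vd] := tangent_bundle_vertical Ux Gw Tw.
exists (row_mx ((row_mx E F)^T *m u)^T (mxvec (E^T *m (D - lift (phi x) P u) *m F))).
rewrite bundle_param_sum /bundle_param row_mxKl row_mxKr trmxK mulmxA EFT.
rewrite (tangent_fix u Ux Mx).1// mxvecK -vertical_mixed//.
by rewrite addrC subrK.
Qed.

(** With row coordinates the drift that u causes in the vertical part stands in the upper right
    block; the zero block says that vertical directions stay vertical. *)
Definition field_mx : 'M[R]_((k + r) + k * r) :=
  block_mx (diag_mx (row_mx mu (- nu)))
    (\matrix_i mxvec (E^T *m vertical_drift (phi x) P (col i (row_mx E F)) *m F))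
    0 (diag_mx (mxvec (\matrix_(i, j) (mu 0 i - nu 0 j)))).

Lemma vec_mx_diag (y : 'rV[R]_(k * r)) :
  vec_mx (y *m diag_mx (mxvec (\matrix_(i, j) (mu 0 i - nu 0 j)))) =
  diag_mx mu *m vec_mx y - vec_mx y *m diag_mx nu.
Proof.
apply/matrixP => i j; rewrite [RHS]mxE [X in _ + X]mxE mul_diag_mx !mul_mx_diag.
by rewrite !mxE mxvecE mxE mulrBr [_ * mu 0 i]mulrC.
Qed.

Lemma field_mx_matrix :
  is_matrix_of (tangent (grassmann_bundle M k) (x, P))
    (mdiff (grassmann_bundle M k) (saddle_field M f k) (x, P))
    (fun i => bundle_param (delta_mx 0 i)) field_mx.
Proof.
split=> [|i]; first exact: bundle_param_basis.
have -> : \sum_j field_mx i j *: bundle_param (delta_mx 0 j) = bundle_param (row i field_mx).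
  rewrite -(bundle_param_sum (row i field_mx)).
  by apply: eq_bigr => j _; congr (_ *: _); rewrite [RHS]mxE.
have Tb := bundle_param_tangent (delta_mx 0 i).
rewrite [in LHS]/bundle_param (mdiff_field Ux Gw g0 PH Tb).
rewrite dfield1_frame commutator_mixed -vec_mx_diag.
(* Horizontal basis vectors come first, vertical ones after them. *)
rewrite /bundle_param; case: (split_ordP i) => j ->.
  have -> : lsubmx (delta_mx 0 (lshift (k * r) j)) = delta_mx 0 j :> 'rV[R]_(k + r).
    by apply/rowP => l; rewrite !mxE (inj_eq (@lshift_inj _ _)).
  have -> : rsubmx (delta_mx 0 (lshift (k * r) j)) = 0 :> 'rV[R]_(k * r).
    by apply/rowP => l; rewrite !mxE eq_rlshift andbF.
  have -> : row (lshift (k * r) j) field_mx =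
      row_mx (delta_mx 0 j *m diag_mx (row_mx mu (- nu)))
        (mxvec (E^T *m vertical_drift (phi x) P (col j (row_mx E F)) *m F)).
    rewrite -rowE; apply/rowP => l; rewrite mxE; case: (split_ordP l) => l' ->.
      by rewrite /field_mx block_mxEul row_mxEl [RHS]mxE.
    by rewrite /field_mx block_mxEur row_mxEr mxE.
  rewrite row_mxKl row_mxKr trmx_mul tr_diag_mx mul0mx linear0 mxvecK.
  rewrite -vertical_mixed.
    congr (_, _ + _); rewrite trmx_delta -colE.
    by rewrite {1}/mixed trmx0 !mulmx0 !mul0mx !addr0.
  exact: vertical_drift_vertical.
have -> : lsubmx (delta_mx 0 (rshift (k + r) j)) = 0 :> 'rV[R]_(k + r).
  by apply/rowP => l; rewrite !mxE eq_lrshift andbF.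
have -> : rsubmx (delta_mx 0 (rshift (k + r) j)) = delta_mx 0 j :> 'rV[R]_(k * r).
  by apply/rowP => l; rewrite !mxE (inj_eq (@rshift_inj _ _)).
have -> : row (rshift (k + r) j) field_mx =
    row_mx 0 (delta_mx 0 j *m diag_mx (mxvec (\matrix_(i, j) (mu 0 i - nu 0 j)))).
  rewrite -rowE; apply/rowP => l; rewrite mxE; case: (split_ordP l) => l' ->.
    by rewrite /field_mx block_mxEdl row_mxEl mxE [RHS]mxE.
  by rewrite /field_mx block_mxEdr row_mxEr [RHS]mxE.
by rewrite row_mxKl row_mxKr trmx0 !mulmx0 vertical_drift0 add0r.
Qed.

(** If the horizontal part of a row eigenvector is nonzero, the eigenvalue is some mu_i or - nu_j;
    otherwise the vertical part is an eigenvector of the last block and the eigenvalue is some mu_i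
    - nu_j. *)
Lemma steady_sufficient :
  (forall i, mu 0 i < 0) -> (forall i, 0 < nu 0 i) ->
  linearly_steady (grassmann_bundle M k) (saddle_field M f k) (x, P).
Proof.
move=> mu0 nu0; split; first exact/(saddle_field_eq0 Ux Gw).
exists ((k + r) + k * r)%N, (fun i => bundle_param (delta_mx 0 i)), field_mx.
split=> [|z /eigenvalueP[v vA v0]]; first exact: field_mx_matrix.
move: vA; rewrite /field_mx map_block_mx !map_diag_mx -[v]hsubmxK mul_row_block.
rewrite map_mx0 mulmx0 addr0 scale_row_mx => /eq_row_mx[v1 v2].
have [l0|l0] := eqVneq (lsubmx v) 0.
  have r0 : rsubmx v != 0.
    by apply: contra v0 => /eqP r0; rewrite -[v]hsubmxK l0 r0 row_mx0.
  move: v2; rewrite l0 mul0mx add0r => /eigenvalue_diag_mx/(_ r0)[s ->].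
  case/mxvec_indexP: s => i j.
  by rewrite !mxE mxvecE mxE/= subr_lt0 (lt_trans (mu0 i)).
have [s ->] := eigenvalue_diag_mx v1 l0.
rewrite mxE/=; case: (split_ordP s) => i ->; rewrite ?row_mxEl ?row_mxEr//.
by rewrite mxE oppr_lt0.
Qed.

End MixedBlocks.

(** * The equivalence inside a chart domain, and the theorem *)

Lemma linearly_steady_iff k x P (lam : d.-tuple R) :
  U x -> grassmann_bundle M k (x, P) ->
  nondegenerate_on (tangent M x) (rhess M f x) ->
  has_eigenvalues (tangent M x) (mulmx (rhess M f x)) lam ->
  sorted <=%R lam ->
  linearly_steady (grassmann_bundle M k) (saddle_field M f k) (x, P) <->
  saddle_point d M f k x /\
  is_orthoproj (first_invariant_subspace (tangent M x) (rhess M f x) lam k) P.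
Proof.
move=> Ux Gw; have [Vx px] := phiK Ux.
have [Mx Pt PP rP TP] := (bundleE k P Ux).1 Gw.
have TE : tangent M x = range (mulmx (tproj (phi x)) : 'cV_n -> 'cV_n).
  by rewrite tangentE//; have [_ _] := colproj_orthoproj (gram_frame Vx).
rewrite /saddle_point rgradE// rhessE// TE => nondeg lamH lam_sorted.
have [Tt TT] := (tproj_sym (phi x), tproj_idem Vx).
have [Ht TH] := (hess_sym Vx, tproj_hess Vx).
split=> [/(steady_necessary Ux Gw)[g0 PH neg pos]|[[_ g0 [lam' [lamH' count']]] low]].
  have [cnt low] := lowest_invariant_projector Tt TT (rank_tproj Vx) Pt PP rP TP
    Ht TH lamH lam_sorted PH neg pos.
  by split=> //; split=> //; exists lam.
have [PH [E [mu [r [F [nu [[EE EP HE mu0] [FF FQ HF nu0]]]]]]]] :=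
  lowest_invariant_splitting Tt TT (rank_tproj Vx) Pt PP rP TP
    Ht TH lamH lam_sorted nondeg lamH' count' low.
exact: (steady_sufficient Ux Gw g0 PH EE EP HE FF FQ HF mu0 nu0).
Qed.

End Function.

End Chart.

Unset Implicit Arguments.

Theorem theorem2 (R : realType) (n d k : nat) (f : 'cV[R]_n -> R)
    (M : set 'cV[R]_n) (xs : 'cV[R]_n) (Ps : 'M[R]_n) (lam : d.-tuple R)
    (f_C3 : Ck_on 3 setT f)
    (M_sub : embedded_submanifold d M)
    (k_ge1 : (1 <= k)%N) (k_lt_d : (k < d)%N)
    (ws_in : grassmann_bundle M k (xs, Ps))
    (hess_nondeg : nondegenerate_on (tangent M xs) (rhess M f xs))
    (lam_eig : has_eigenvalues (tangent M xs) (mulmx (rhess M f xs)) lam)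
    (lam_sorted : sorted <=%R lam)
    (lam_gap : lam`_k.-1 < lam`_k) :
  linearly_steady (grassmann_bundle M k) (saddle_field M f k) (xs, Ps) <->
  saddle_point d M f k xs /\
  is_orthoproj
    (first_invariant_subspace (tangent M xs) (rhess M f xs) lam k) Ps.
Proof.
have Mx : M xs by case: ws_in.
have [dn /(_ xs Mx)[U [V [phi [psi [[oU Ux oV Sphi Spsi] [phiK psiK MU]]]]]]] := M_sub.
exact: (linearly_steady_iff dn oU oV Sphi Spsi phiK psiK MU f_C3).
Qed.
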